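(* Given a polynomial-time $\beta$-approximation algorithm for CFL (capacitated facility location with arbitrary, possibly non-uniform, capacities), a polynomial-time $\beta$-approximation algorithm for CPFL can be obtained.
   Context: CFL: given a metric $c$ on a finite set $V$, facilities $\mathcal{F}\subseteq V$ with opening costs $f_i\ge0$ and capacities $u_i$, and clients $\mathcal{C}\subseteq V$, open $\mathcal{F}'\subseteq\mathcal{F}$ and assign $\phi:\mathcal{C}\to\mathcal{F}'$ with $|\phi^{-1}(i)|\le u_i$ for all $i$, minimising $\sum_{i\in\mathcal{F}'}f_i+\sum_{j\in\mathcal{C}}c(j,\phi(j))$. CPFL (capacitated prize-collecting facility location): additionally each client $j$ has a penalty $p_j\ge0$; the solution chooses a set $\mathcal{C}_p\subseteq\mathcal{C}$ of clients that pay their penalty and assigns only $\mathcal{C}\setminus\mathcal{C}_p$ (respecting capacities), minimising $\sum_{i\in\mathcal{F}'}f_i+\sum_{j\in\mathcal{C}\setminus\mathcal{C}_p}c(j,\phi(j))+\sum_{j\in\mathcal{C}_p}p_j$. *)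

(* Defs.v *)
From mathcomp Require Import all_boot all_order all_algebra.
From mathcomp Require Import reals.

Set Implicit Arguments.
Unset Strict Implicit.
Unset Printing Implicit Defensive.

Import Order.TTheory GRing.Theory Num.Theory.
Local Open Scope ring_scope.

(* Model of computation: WHILE programs over binary trees, in the style of
   N. D. Jones, "Computability and Complexity", but with rational numbers at
   the leaves and with logarithmic cost: every evaluation of a subexpression is
   charged the bit size of its value.  Each primitive is computable in time
   polynomial in the bit sizes of its arguments and result, which are all
   charged, and the store cannot grow by more than the charged time; hence
   polynomial time here is polynomial time on a Turing machine. *)

Inductive val : Type :=
  | Num of rat
  | Pair of val & val.

Definition bits (n : nat) : nat := (trunc_log 2 n).+1.

(* The summand 1 pays for the sign. *)
Definition rat_size (q : rat) : nat :=
  (1 + bits `|numq q|%N + bits `|denq q|%N)%N.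

Fixpoint val_size (v : val) : nat :=
  match v with
  | Num q => rat_size q
  | Pair v1 v2 => (1 + val_size v1 + val_size v2)%N
  end.

Inductive unop : Type := Fst | Snd | IsPair | Numer.
Inductive binop : Type := MkPair | Add | Sub | Mul | Div | Le.

Inductive expr : Type :=
  | Var of nat
  | Const of rat
  | Un of unop & expr
  | Bin of binop & expr & expr.

Inductive prog : Type :=
  | Skip
  | Assign of nat & expr
  | Seq of prog & prog
  | If of expr & prog & prog
  | While of expr & prog.

Definition of_bool (b : bool) : val := Num b%:R.

(* 0 also plays the role of the empty list. *)
Definition truthy (v : val) : bool := if v is Num q then q != 0 else true.

(* An operation applied to arguments of the wrong shape returns 0. *)
Definition eval_unop (o : unop) (v : val) : val :=
  match o, v with
  | Fst, Pair v1 _ => v1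
  | Snd, Pair _ v2 => v2
  | IsPair, Pair _ _ => of_bool true
  | Numer, Num q => Num (numq q)%:~R
  | _, _ => Num 0
  end.

Definition eval_binop (o : binop) (v w : val) : val :=
  match o, v, w with
  | MkPair, _, _ => Pair v w
  | Add, Num x, Num y => Num (x + y)
  | Sub, Num x, Num y => Num (x - y)
  | Mul, Num x, Num y => Num (x * y)
  | Div, Num x, Num y => Num (x / y)
  | Le, Num x, Num y => of_bool (x <= y)
  | _, _, _ => Num 0
  end.

Definition store : Type := nat -> val.

Definition update (s : store) (x : nat) (v : val) : store :=
  fun y => if y == x then v else s y.

Fixpoint eval (s : store) (e : expr) : val :=
  match e with
  | Var x => s x
  | Const q => Num q
  | Un o e1 => eval_unop o (eval s e1)
  | Bin o e1 e2 => eval_binop o (eval s e1) (eval s e2)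
  end.

Fixpoint eval_cost (s : store) (e : expr) : nat :=
  (val_size (eval s e) +
   match e with
   | Var _ | Const _ => 0
   | Un _ e1 => eval_cost s e1
   | Bin _ e1 e2 => eval_cost s e1 + eval_cost s e2
   end)%N.

(* [exec c s t s']: started in s, the program c halts in s' after time t. *)
Inductive exec : prog -> store -> nat -> store -> Prop :=
  | ExecSkip s :
      exec Skip s 1 s
  | ExecAssign x e s :
      exec (Assign x e) s (eval_cost s e) (update s x (eval s e))
  | ExecSeq c1 c2 s s1 s2 t1 t2 :
      exec c1 s t1 s1 -> exec c2 s1 t2 s2 ->
      exec (Seq c1 c2) s (t1 + t2) s2
  | ExecIf e c1 c2 s s' t :
      exec (if truthy (eval s e) then c1 else c2) s t s' ->
      exec (If e c1 c2) s (eval_cost s e + t) s'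
  | ExecWhileStop e c s :
      ~~ truthy (eval s e) ->
      exec (While e c) s (eval_cost s e) s
  | ExecWhileStep e c s s1 s2 t1 t2 :
      truthy (eval s e) ->
      exec c s t1 s1 -> exec (While e c) s1 t2 s2 ->
      exec (While e c) s (eval_cost s e + t1 + t2) s2.

(* Variable 0 holds the input at the start and the output at the end. *)
Definition computes (c : prog) (input : val) (t : nat) (output : val) : Prop :=
  exists s, exec c (update (fun _ => Num 0) 0%N input) t s /\ s 0%N = output.

Record min_problem : Type := MinProblem {
  instance : Type;
  solution : instance -> Type;
  feasible : forall I : instance, solution I -> Prop;
  cost : forall I : instance, solution I -> rat;
  enc_instance : instance -> val;
  enc_solution : forall I : instance, solution I -> val
}.

Definition optimal (P : min_problem) (I : instance P) (s : solution I) : Prop :=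
  feasible s /\ forall s' : solution I, feasible s' -> cost s <= cost s'.

(* The program halts in polynomial time on every instance; on an instance
   without feasible solution its output is unconstrained. *)
Definition poly_time_approx (R : realType) (beta : R) (P : min_problem)
    (c : prog) : Prop :=
  exists q : {poly nat}, forall I : instance P, exists t v,
    [/\ computes c (enc_instance I) t v,
        (t <= q.[val_size (enc_instance I)])%N
      & forall opt : solution I, optimal opt ->
        exists s : solution I,
          [/\ v = enc_solution s, feasible s
            & ratr (cost s) <= beta * ratr (cost opt)]].

Definition is_metric (T : Type) (d : T -> T -> rat) : Prop :=
  [/\ forall x y, 0 <= d x y,
      forall x y, d x y = 0 <-> x = y,
      forall x y, d x y = d y x
    & forall x y z, d x z <= d x y + d y z].

(* The opening costs and capacities of points that are not facilities are
   irrelevant: they are neither encoded nor used. *)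
Record cfl_instance : Type := CFLInstance {
  npoints : nat;
  dist : 'I_npoints -> 'I_npoints -> rat;
  dist_metric : is_metric dist;
  facilities : {set 'I_npoints};
  clients : {set 'I_npoints};
  opening : 'I_npoints -> rat;
  opening_ge0 : forall i, i \in facilities -> 0 <= opening i;
  capacity : 'I_npoints -> nat
}.

Record cpfl_instance : Type := CPFLInstance {
  cpfl_base :> cfl_instance;
  penalty : 'I_(npoints cpfl_base) -> rat;
  penalty_ge0 : forall j, j \in clients cpfl_base -> 0 <= penalty j
}.

(* [assigned j] is meaningful only for the clients j that are served. *)
Record cfl_solution (I : cfl_instance) : Type := CFLSolution {
  opened : {set 'I_(npoints I)};
  assigned : 'I_(npoints I) -> 'I_(npoints I)
}.

Record cpfl_solution (I : cpfl_instance) : Type := CPFLSolution {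
  cpfl_assignment :> cfl_solution I;
  paying : {set 'I_(npoints I)}
}.

(* D is the set of clients that are served. *)
Definition serves (I : cfl_instance) (D : {set 'I_(npoints I)})
    (s : cfl_solution I) : Prop :=
  [/\ opened s \subset facilities I,
      forall j, j \in D -> assigned s j \in opened s
    & forall i, i \in opened s ->
        (#|[set j in D | assigned s j == i]| <= capacity i)%N].

Definition service_cost (I : cfl_instance) (D : {set 'I_(npoints I)})
    (s : cfl_solution I) : rat :=
  \sum_(i in opened s) opening i + \sum_(j in D) dist j (assigned s j).

Definition served (I : cpfl_instance) (s : cpfl_solution I) :
    {set 'I_(npoints I)} :=
  clients I :\: paying s.

Definition cfl_feasible (I : cfl_instance) (s : cfl_solution I) : Prop :=
  serves (clients I) s.

Definition cfl_cost (I : cfl_instance) (s : cfl_solution I) : rat :=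
  service_cost (clients I) s.

Definition cpfl_feasible (I : cpfl_instance) (s : cpfl_solution I) : Prop :=
  paying s \subset clients I /\ serves (served s) s.

Definition cpfl_cost (I : cpfl_instance) (s : cpfl_solution I) : rat :=
  service_cost (served s) s + \sum_(j in paying s) penalty j.

Definition enc_nat (n : nat) : val := Num n%:R.

Definition enc_list (vs : seq val) : val := foldr Pair (Num 0) vs.

(* Points are numbered 0, ..., n - 1 and sets are listed in increasing order;
   all numbers, capacities included, are in binary (see [rat_size]). *)
Definition enc_set (n : nat) (A : {set 'I_n}) : val :=
  enc_list [seq enc_nat (nat_of_ord i) | i <- enum A].

Definition enc_cfl_instance (I : cfl_instance) : val :=
  enc_list
    [:: enc_nat (npoints I);
        enc_list [seq enc_list [seq Num (dist x y) | y <- enum 'I_(npoints I)]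
                 | x <- enum 'I_(npoints I)];
        enc_list [seq enc_list [:: enc_nat (nat_of_ord i); Num (opening i);
                                   enc_nat (capacity i)]
                 | i <- enum (facilities I)];
        enc_set (clients I)].

Definition enc_cpfl_instance (I : cpfl_instance) : val :=
  Pair (enc_cfl_instance I)
       (enc_list [seq Num (penalty j) | j <- enum (clients I)]).

Definition enc_assignment (I : cfl_instance) (D : {set 'I_(npoints I)})
    (s : cfl_solution I) : val :=
  Pair (enc_set (opened s))
       (enc_list [seq Pair (enc_nat (nat_of_ord j)) (enc_nat (assigned s j))
                 | j <- enum D]).

Definition enc_cfl_solution (I : cfl_instance) (s : cfl_solution I) : val :=
  enc_assignment (clients I) s.

Definition enc_cpfl_solution (I : cpfl_instance) (s : cpfl_solution I) : val :=
  Pair (enc_assignment (served s) s) (enc_set (paying s)).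

Definition CFL : min_problem :=
  MinProblem cfl_feasible cfl_cost enc_cfl_instance enc_cfl_solution.

Definition CPFL : min_problem :=
  MinProblem cpfl_feasible cpfl_cost enc_cpfl_instance enc_cpfl_solution.

(* Main.v *)
(** Replace the penalty of a client [j] by a dummy facility of capacity 1 and
    opening cost 0 at the end of a pendant edge of length [p_j] attached to [j]:
    serving [j] from its own dummy costs exactly [p_j].  The length must be
    positive for the distance to be a metric, so the clients of penalty 0 are
    dropped; they can pay for free.  Conversely, a CFL solution may assign
    another client [k] to the dummy of [j].  Swapping the assignments of [j] and
    [k] does not increase the cost, by the triangle inequality through [j], and
    after one swap per client every dummy in use serves its own client, which
    then pays its penalty.  So the two optima are equal and solutions translate
    back at no loss.

    For the running time, [ptime inp f] says that [f x] is computable from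
    [inp x] in polynomial time, where [x] ranges over an arbitrary type of
    mathematical objects.  This relation is closed under composition, pairing,
    arithmetic and folds over encoded lists with accumulators of polynomial
    size. *)

Require Import Defs.
From mathcomp Require Import all_boot all_order all_algebra all_fingroup.
From mathcomp Require Import reals.
From mathcomp Require boolp.
From mathcomp Require Import zify lra.
(* [val] would otherwise denote the subtype projection of MathComp. *)
Import Defs.

Set Implicit Arguments.
Unset Strict Implicit.
Unset Printing Implicit Defensive.

Import Order.TTheory GRing.Theory Num.Theory.

(** * Sizes and the frame property *)

(** Coefficients in [nat] are nonnegative, so every monomial is monotone. This allows a bound on a
    size to be substituted into a time bound. *)
Lemma horner_nat_mono (q : {poly nat}) (m n : nat) :
  m <= n -> q.[m]%R <= q.[n]%R.
Proof.
move=> le_mn; rewrite !horner_coef; elim/big_ind2: _ => // [a b c d|i _].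
  exact: leq_add.
rewrite natrME leq_mul2l; apply/orP; right; rewrite !natrXE.
by case: (nat_of_ord i) => // k; rewrite leq_exp2r.
Qed.

(** * Polynomial bounds *)

Definition poly_bounded (X : Type) (N T : X -> nat) : Prop :=
  exists q : {poly nat}, forall x, T x <= q.[N x]%R.

Section PolynomialBounds.

Variables (X : Type) (N : X -> nat).

Lemma poly_bounded_id : poly_bounded N N.
Proof. by exists 'X%R => x; rewrite hornerX. Qed.

Lemma poly_bounded_const k : poly_bounded N (fun=> k).
Proof. by exists (k%:P)%R => x; rewrite hornerC. Qed.

Lemma poly_bounded_add T1 T2 :
  poly_bounded N T1 -> poly_bounded N T2 ->
    poly_bounded N (fun x => T1 x + T2 x).
Proof.
by move=> [q1 h1] [q2 h2]; exists (q1 + q2)%R => x; rewrite hornerD leq_add.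
Qed.

Lemma poly_bounded_mul T1 T2 :
  poly_bounded N T1 -> poly_bounded N T2 ->
    poly_bounded N (fun x => T1 x * T2 x).
Proof.
by move=> [q1 h1] [q2 h2]; exists (q1 * q2)%R => x; rewrite hornerM leq_mul.
Qed.

Lemma poly_bounded_le T1 T2 : (forall x, T1 x <= T2 x) -> poly_bounded N T2 ->
  poly_bounded N T1.
Proof. by move=> le12 [q h]; exists q => x; apply: leq_trans (h x). Qed.

Lemma poly_bounded_trans M T : poly_bounded N M -> poly_bounded M T ->
  poly_bounded N T.
Proof.
move=> [q1 h1] [q2 h2]; exists (q2 \Po q1)%R => x; rewrite horner_comp.
exact: leq_trans (h2 x) (horner_nat_mono q2 (h1 x)).
Qed.

Lemma poly_bounded_horner M (q : {poly nat}) :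
  poly_bounded N M -> poly_bounded N (fun x => q.[M x]%R).
Proof. by move=> hM; apply: poly_bounded_trans hM _; exists q. Qed.

End PolynomialBounds.

Ltac polyb_tac :=
  repeat first [ assumption | apply: poly_bounded_id | apply: poly_bounded_const
               | apply: poly_bounded_add | apply: poly_bounded_mul | apply:
                 poly_bounded_horner ].

(** * Bit sizes of numbers and growth of the store *)

Lemma size_of_bool b : val_size (of_bool b) = 3.
Proof. by case: b. Qed.

Lemma bits_le m n : m <= n -> bits m <= bits n.
Proof. by move=> le_mn; rewrite ltnS leq_trunc_log. Qed.

Lemma ltn_bits n : n < 2 ^ bits n.
Proof. exact: trunc_log_ltn. Qed.

Lemma bits_bound n k : n < 2 ^ k.+1 -> bits n <= k.+1.
Proof.
case: n => [_|n lt_nk]; first by rewrite /bits trunc_log0.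
rewrite /bits -(ltn_exp2l _ _ (isT : 1 < 2)).
exact: leq_ltn_trans (trunc_logP _ _) lt_nk.
Qed.

Lemma bits_mul m n : bits (m * n) <= bits m + bits n.
Proof.
apply: bits_bound; rewrite -addSn -/(bits m) expnD.
by apply: ltn_mul; apply: ltn_bits.
Qed.

Lemma bits_add m n : bits (m + n) <= bits m + bits n.
Proof.
apply: bits_bound.
have le1 : 2 ^ bits m <= 2 ^ (trunc_log 2 m + bits n).
  by rewrite leq_exp2l // addnS ltnS leq_addr.
have le2 : 2 ^ bits n <= 2 ^ (trunc_log 2 m + bits n).
  by rewrite leq_exp2l // leq_addl.
rewrite expnS mul2n -addnn.
apply: (@leq_trans (2 ^ bits m + 2 ^ bits n)); last exact: leq_add.
by rewrite -addSn leq_add // ?ltn_bits // ltnW ?ltn_bits.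
Qed.

(** The reduced form arises from [a / b] by cancelling a nonzero common factor [k]. *)
Lemma rat_frac_le (a b : int) (z : rat) : b != 0%R ->
  z = (a%:~R / b%:~R)%R -> `|numq z| <= `|a| /\ `|denq z| <= `|b|.
Proof.
move=> b0 ez; have := @valq_frac (a, b) b0; rewrite fracqE -ez.
move: (scalq _) => k [ea eb].
have k0 : k != 0%R by apply: contraNneq b0 => k0; rewrite eb k0 mul0r.
rewrite ea eb !abszM; split; apply: leq_pmull; rewrite absz_gt0; exact: k0.
Qed.

(** Cross-multiplication gives an unreduced fraction. Each denominator of a summand enters both its
    numerator and its denominator, hence the factor 2. *)
Lemma rat_size_add (x y : rat) :
  rat_size (x + y)%R <= (rat_size x + rat_size y) * 2.
Proof.
have d0 z : ((denq z)%:~R != 0 :> rat)%R by rewrite intr_eq0 denq_neq0.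
have [] := @rat_frac_le (numq x * denq y + numq y * denq x)%R
  (denq x * denq y)%R (x + y)%R.
- by rewrite mulf_neq0 ?denq_neq0.
- rewrite intrD !intrM -addf_div ?d0 //.
  by rewrite !divq_num_den.
move=> /bits_le hn /bits_le hd; rewrite /rat_size.
have h1 : `|(numq x * denq y + numq y * denq x)%R| <=
    `|numq x| * `|denq y| + `|numq y| * `|denq x|.
  by rewrite -!abszM; lia.
have := bits_le h1.
have := bits_add (`|numq x| * `|denq y|) (`|numq y| * `|denq x|).
have := bits_mul `|numq x| `|denq y|; have := bits_mul `|numq y| `|denq x|.
move: hd; rewrite abszM; have := bits_mul `|denq x| `|denq y|.
lia.
Qed.

Lemma bits_leS n : bits n <= n.+1.
Proof.
apply: bits_bound; apply: (@ltn_trans (2 ^ n)); first exact: ltn_expl.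
by rewrite ltn_exp2l.
Qed.

Lemma size_enc_nat n : val_size (enc_nat n) <= n + 3.
Proof.
rewrite /= /rat_size.
have -> : ((n%:R : rat) = (n : int)%:~R)%R by [].
rewrite numq_int denq_int /=; have bits1 : bits 1 = 1 by [].
have := bits_leS n; lia.
Qed.

Lemma eval_size s e : val_size (eval s e) <= eval_cost s e.
Proof. by case: e => *; rewrite /= leq_addr. Qed.

(** An assignment pays for the size of the value that it stores, so size bounds follow from time
    bounds. *)
Lemma exec_size c s t s' : exec c s t s' ->
  forall y, val_size (s' y) <= val_size (s y) + t.
Proof.
elim=> {c s t s'} [s y|x e s y|c1 c2 s s1 s2 t1 t2 _ h1 _ h2 y
  |e c1 c2 s s' t _ h y|e c s _ y|e c s s1 s2 t1 t2 _ _ h1 _ h2 y].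
- exact: leq_addr.
- rewrite /update; case: eqP => _; last exact: leq_addr.
  exact: leq_trans (eval_size _ _) (leq_addl _ _).
- by have := h1 y; have := h2 y; lia.
- by have := h y; lia.
- exact: leq_addr.
- by have := h1 y; have := h2 y; lia.
Qed.

(** * Registers that a program does not mention *)

Section Frame.

Fixpoint expr_bound (e : expr) : nat :=
  match e with
  | Var x => x.+1
  | Const _ => 0
  | Un _ e1 => expr_bound e1
  | Bin _ e1 e2 => maxn (expr_bound e1) (expr_bound e2)
  end.

Fixpoint prog_bound (c : prog) : nat :=
  match c with
  | Skip => 0
  | Assign x e => maxn x.+1 (expr_bound e)
  | Seq c1 c2 => maxn (prog_bound c1) (prog_bound c2)
  | If e c1 c2 => maxn (expr_bound e) (maxn (prog_bound c1) (prog_bound c2))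
  | While e c => maxn (expr_bound e) (prog_bound c)
  end.

Lemma eval_frame B (s1 s2 : store) e :
  (forall y, y < B -> s1 y = s2 y) -> expr_bound e <= B ->
  eval s1 e = eval s2 e /\ eval_cost s1 e = eval_cost s2 e.
Proof.
move=> eq12; elim: e => [x|q|o e IH|o e1 IH1 e2 IH2] /=.
- by move=> /eq12->.
- by [].
- by move=> /IH[-> ->].
- by rewrite geq_max => /andP[/IH1[-> ->] /IH2[-> ->]].
Qed.

(** A given program is only known to run from a store that is 0 outside the input. This moves its
    run to a store where the registers from [B] on hold saved data. *)
Lemma exec_frame B c s t s' : exec c s t s' -> prog_bound c <= B ->
  forall s2 : store, (forall y, y < B -> s y = s2 y) ->
  exists s2', [/\ exec c s2 t s2', forall y, y < B -> s' y = s2' y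
    & forall y, B <= y -> s2' y = s2 y].
Proof.
elim=> {c s t s'} [s|x e s|c1 c2 s sa sb t1 t2 _ h1 _ h2
  |e c1 c2 s s' t _ h|e c s fe|e c s sa sb t1 t2 te _ h1 _ h2] /=.
- by move=> _ s2 eq2; exists s2; split=> //; apply: ExecSkip.
- rewrite geq_max => /andP[ltx /eval_frame h] s2 eq2.
  have [-> ->] := h _ _ eq2; exists (update s2 x (eval s2 e)); split.
  + exact: ExecAssign.
  + by move=> y ltyB; rewrite /update; case: eqP => // _; apply: eq2.
  + by move=> y leBy; rewrite /update; case: eqP => // ?; lia.
- rewrite geq_max => /andP[b1 b2] s2 eq2.
  have [s2a [e1 f1 g1]] := h1 b1 _ eq2; have [s2b [e2 f2 g2]] := h2 b2 _ f1.
  exists s2b; split=> //; first exact: ExecSeq e1 e2.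
  by move=> y leBy; rewrite g2 // g1.
- rewrite !geq_max => /and3P[be b1 b2] s2 eq2.
  have [ev ec] := eval_frame eq2 be.
  have [|s2' [e' f' g']] := h _ s2 eq2; first by case: ifP.
  exists s2'; split=> //; rewrite ec; apply: ExecIf.
  by rewrite -ev.
- rewrite geq_max => /andP[be _] s2 eq2.
  have [ev ec] := eval_frame eq2 be.
  by exists s2; split=> //; rewrite ec; apply: ExecWhileStop; rewrite -ev.
- rewrite geq_max => /andP[be bc] s2 eq2.
  have [ev ec] := eval_frame eq2 be.
  have [s2a [e1 f1 g1]] := h1 bc _ eq2.
  have [|s2b [e2 f2 g2]] := h2 _ _ f1; first by rewrite geq_max be.
  exists s2b; split=> //; first by rewrite ec; apply: ExecWhileStep e1 e2;
    rewrite -ev.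
  by move=> y leBy; rewrite g2 // g1.
Qed.

End Frame.

(** * Polynomial-time computability *)

(* The program may be placed at any register [r]: it uses the registers from [r]
   on, whose initial content is arbitrary, and leaves those below [r] alone. *)
Definition ptime (X : Type) (inp f : X -> val) : Prop :=
  forall r : nat, exists (c : prog) (q : {poly nat}),
  forall (x : X) (s : store), s r = inp x -> exists t s',
  [/\ exec c s t s', s' r = f x, forall y, y < r -> s' y = s y
    & t <= q.[val_size (inp x)]%R].

Lemma update_eq s x v : update s x v x = v.
Proof. by rewrite /update eqxx. Qed.

Lemma update_neq s x v y : y != x -> update s x v y = s y.
Proof. by rewrite /update => /negPf->. Qed.

Ltac upd := repeat first [rewrite update_eq | rewrite update_neq; last lia].

Lemma val_size_ge3 v : 3 <= val_size v.
Proof.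
by elim: v => [q|v1 _ v2 IH] /=; [rewrite /rat_size /bits; lia|lia].
Qed.

(** The result sits in a register that held the input, and a register grows by at most the running
    time. *)
Lemma ptime_size X (inp f : X -> val) :
  ptime inp f -> poly_bounded (fun x => val_size (inp x))
    (fun x => val_size (f x)).
Proof.
move=> /(_ 0)[c [q h]].
apply: (@poly_bounded_le _ _ _ (fun x => val_size (inp x)
  + q.[val_size (inp x)]%R)).
  move=> x; have [//|t [s' [e <- _ le_t]]] := h x (fun=> inp x).
  by apply: leq_trans (exec_size e 0) _; rewrite leq_add2l.
by polyb_tac.
Qed.

(** * Closure properties of [ptime] *)

Section Combinators.

Variables (X : Type) (inp : X -> val).

Lemma ptime_id : ptime inp inp.
Proof.
move=> r; exists Skip, 1%R => x s sr; exists 1, s; split=> //.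
  exact: ExecSkip.
by rewrite hornerC.
Qed.

Lemma ptime_ext f g : f =1 g -> ptime inp f -> ptime inp g.
Proof.
move=> fg hf r; have [c [q h]] := hf r; exists c, q => x s /h.
by rewrite -fg.
Qed.

(** The second running time is polynomial in the size of the intermediate value, which is itself
    polynomial in the input size by [ptime_size]. *)
Lemma ptime_comp f g : ptime inp f -> ptime f g -> ptime inp g.
Proof.
move=> hf hg r; have [c1 [q1 h1]] := hf r; have [c2 [q2 h2]] := hg r.
have [q3 h3] := ptime_size hf.
exists (Seq c1 c2), (q1 + (q2 \Po q3))%R => x s sr.
have [t1 [s1 [e1 r1 f1 le1]]] := h1 x s sr.
have [t2 [s2 [e2 r2 f2 le2]]] := h2 x s1 r1.
exists (t1 + t2), s2; split=> //; first exact: ExecSeq e1 e2.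
  by move=> y ltyr; rewrite f2 // f1.
rewrite hornerD horner_comp leq_add // (leq_trans le2) //.
exact: horner_nat_mono.
Qed.

Lemma ptime_num z : ptime inp (fun=> Num z).
Proof.
move=> r; exists (Assign r (Const z)), (rat_size z)%:P%R => x s sr.
exists (eval_cost s (Const z)), (update s r (Num z)); split.
- exact: ExecAssign.
- by upd.
- by move=> y ltyr; upd.
- by rewrite hornerC /= addn0.
Qed.

Lemma ptime_pair f g : ptime inp f -> ptime inp g ->
  ptime inp (fun x => Pair (f x) (g x)).
Proof.
move=> hf hg r; have [c1 [q1 h1]] := hf r.+1; have [c2 [q2 h2]] := hg r.+2.
have [q3 h3] := ptime_size hf; have [q4 h4] := ptime_size hg.
(* Each program works on a fresh copy of the input, above the registers to be kept: the input in
   [r], then also the first component in [r.+1]. *)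
exists (Seq (Assign r.+1 (Var r)) (Seq c1 (Seq (Assign r.+2 (Var r))
  (Seq c2 (Assign r (Bin MkPair (Var r.+1) (Var r.+2))))))).
have [q hq] : poly_bounded (fun x => val_size (inp x)) (fun x =>
  val_size (inp x) * 2 + q1.[val_size (inp x)]%R + q2.[val_size (inp x)]%R
  + (1 + q3.[val_size (inp x)]%R * 2 + q4.[val_size (inp x)]%R * 2)).
  by polyb_tac.
exists q => x s sr.
have [|t1 [s1 [e1 r1 f1 le1]]] := h1 x (update s r.+1 (inp x)); first by upd.
have [|t2 [s2 [e2 r2 f2 le2]]] := h2 x (update s1 r.+2 (inp x)); first by upd.
have s1r : s1 r = inp x by rewrite f1 //; upd.
have s2r : s2 r.+1 = f x by rewrite f2 //; upd.
eexists; eexists; split.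
- apply: ExecSeq; first exact: ExecAssign.
  rewrite /= sr; apply: ExecSeq; first exact: e1.
  apply: ExecSeq; first exact: ExecAssign.
  rewrite /= s1r; apply: ExecSeq; first exact: e2.
  exact: ExecAssign.
- by upd; rewrite /= s2r r2.
- move=> y ltyr; upd; rewrite f2 ?f1; try lia; upd; rewrite f1; try lia.
  by upd.
apply: leq_trans (hq x); rewrite /= sr s1r s2r r2.
by have := h3 x; have := h4 x; lia.
Qed.

Lemma ptime_unop o f : (forall v, val_size (eval_unop o v) <= val_size v) ->
  ptime inp f -> ptime inp (fun x => eval_unop o (f x)).
Proof.
move=> ho hf; apply: ptime_comp hf _ => r.
exists (Assign r (Un o (Var r))), ('X + 'X)%R => x s sr.
exists (eval_cost s (Un o (Var r))), (update s r (eval_unop o (f x))); split.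
- by rewrite -[in update _ _ _]sr; apply: ExecAssign.
- by upd.
- by move=> y ltyr; upd.
- by rewrite !(hornerD, hornerX) /= sr addn0 leq_add.
Qed.

Lemma ptime_fst f : ptime inp f -> ptime inp (fun x => eval_unop Fst (f x)).
Proof.
by apply: ptime_unop => -[q|v1 v2]; [exact: val_size_ge3|rewrite /=; lia].
Qed.

Lemma ptime_snd f : ptime inp f -> ptime inp (fun x => eval_unop Snd (f x)).
Proof.
by apply: ptime_unop => -[q|v1 v2]; [exact: val_size_ge3|rewrite /=; lia].
Qed.

Lemma ptime_binop o f g (h : {poly nat}) :
  (forall x, val_size (eval_binop o (f x) (g x))
    <= h.[val_size (Pair (f x) (g x))]%R) ->
  ptime inp f -> ptime inp g -> ptime inp (fun x => eval_binop o (f x) (g x)).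
Proof.
move=> ho hf hg; apply: ptime_comp (ptime_pair hf hg) _ => r.
exists (Assign r (Bin o (Un Fst (Var r)) (Un Snd (Var r)))).
(* [h] pays for the result; the pair is read twice, and its two projections together are smaller
   than the pair. *)
exists (h + 'X + 'X + 'X)%R => x s sr.
eexists; eexists; split; first exact: ExecAssign.
- by upd; rewrite /= sr.
- by move=> y ltyr; upd.
- rewrite !(hornerD, hornerX) /= sr !natrDE; have := ho x; rewrite /=; lia.
Qed.

Lemma ptime_add (f g : X -> rat) : ptime inp (fun x => Num (f x)) ->
  ptime inp (fun x => Num (g x)) -> ptime inp (fun x => Num (f x + g x)%R).
Proof.
apply: (@ptime_binop Add _ _ ('X * 2%:P)%R) => x.
rewrite !(hornerM, hornerX, hornerC) /=.
apply: leq_trans (rat_size_add _ _) _; rewrite natrME; lia.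
Qed.

Lemma ptime_le (f g : X -> rat) : ptime inp (fun x => Num (f x)) ->
  ptime inp (fun x => Num (g x)) -> ptime inp (fun x => of_bool (f x <= g x)%R).
Proof.
apply: (@ptime_binop Le _ _ 3%:P%R) => x.
by rewrite [eval_binop _ _ _]/= size_of_bool hornerC.
Qed.

Lemma truthy_of_bool b : truthy (of_bool b) = b.
Proof. by case: b. Qed.

Lemma ptime_if b f g : ptime inp (fun x => of_bool (b x)) ->
  ptime inp f -> ptime inp g -> ptime inp (fun x => if b x then f x else g x).
Proof.
move=> hb hf hg r; have [c0 [q0 h0]] := hb r.+1.
have [c1 [q1 h1]] := hf r; have [c2 [q2 h2]] := hg r.
exists (Seq (Assign r.+1 (Var r)) (Seq c0 (If (Var r.+1) c1 c2))).
exists ('X + (q0 + (3%:P + (q1 + q2))))%R => x s sr.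
have [|t0 [s0 [e0 r0 f0 le0]]] := h0 x (update s r.+1 (inp x)); first by upd.
have s0r : s0 r = inp x by rewrite f0 //; upd.
have [t1 [s1 [e1 r1 f1 le1]]] := h1 x s0 s0r.
have [t2 [s2 [e2 r2 f2 le2]]] := h2 x s0 s0r.
exists (val_size (inp x) + (t0 + (3 + if b x then t1 else t2))).
exists (if b x then s1 else s2); split.
- apply: ExecSeq; first by rewrite -sr -[val_size _]addn0; apply: ExecAssign.
  rewrite /= sr; apply: ExecSeq; first exact: e0.
  have -> : 3 = eval_cost s0 (Var r.+1) by rewrite /= r0 size_of_bool.
  by apply: ExecIf; rewrite /= r0 truthy_of_bool; case: (b x).
- by case: (b x).
- by move=> y ltyr; case: (b x); rewrite ?f1 ?f2 // f0 ?update_neq //; lia.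
- by rewrite !(hornerD, hornerX, hornerC) !natrDE; case: (b x); lia.
Qed.

Lemma ptime_bool (b : bool) : ptime inp (fun=> of_bool b).
Proof. exact: ptime_num. Qed.

Lemma ptime_not b : ptime inp (fun x => of_bool (b x)) ->
  ptime inp (fun x => of_bool (~~ b x)).
Proof.
move=> hb; apply: ptime_ext (ptime_if hb (ptime_bool false) (ptime_bool true))
  => x.
by case: (b x).
Qed.

Lemma ptime_and b1 b2 : ptime inp (fun x => of_bool (b1 x)) ->
  ptime inp (fun x => of_bool (b2 x)) -> ptime inp (fun x => of_bool (b1 x &&
    b2 x)).
Proof.
move=> hb1 hb2; apply: ptime_ext (ptime_if hb1 hb2 (ptime_bool false)) => x.
by case: (b1 x).
Qed.

Lemma ptime_addn (f g : X -> nat) : ptime inp (fun x => enc_nat (f x)) ->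
  ptime inp (fun x => enc_nat (g x)) ->
    ptime inp (fun x => enc_nat (f x + g x)).
Proof.
move=> hf hg; apply: ptime_ext (ptime_add hf hg) => x.
by rewrite -natrD.
Qed.

Lemma ptime_leq (f g : X -> nat) : ptime inp (fun x => enc_nat (f x)) ->
  ptime inp (fun x => enc_nat (g x)) ->
    ptime inp (fun x => of_bool (f x <= g x)).
Proof.
move=> hf hg; apply: ptime_ext (ptime_le hf hg) => x.
by rewrite ler_nat.
Qed.

(** Antisymmetry reduces equality to the primitive [Le]. *)
Lemma ptime_eqn (f g : X -> nat) : ptime inp (fun x => enc_nat (f x)) ->
  ptime inp (fun x => enc_nat (g x)) ->
    ptime inp (fun x => of_bool (f x == g x)).
Proof.
move=> hf hg; apply: ptime_ext (ptime_and (ptime_leq hf hg) (ptime_leq hg hf))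
  => x.
by rewrite eqn_leq.
Qed.

End Combinators.

(** Substitution along [p]: a computation proved in one context is reused in another that can
    produce its input. Weakening and reordering of variables are instances. *)
Lemma ptime_reindex X Y (p : Y -> X) (inp f : X -> val) (inp' : Y -> val) :
  ptime inp f -> ptime inp' (fun y => inp (p y)) ->
    ptime inp' (fun y => f (p y)).
Proof.
move=> hf hp; apply: ptime_comp hp _ => r.
by have [c [q h]] := hf r; exists c, q => y; apply: (h (p y)).
Qed.

(* The input of a computation with one more variable in scope, of a type that
   may depend on the earlier ones. *)
Definition extend (X : Type) (inp : X -> val) (T : X -> Type)
    (e : forall x, T x -> val) (y : {x & T x}) : val :=
  Pair (e (tag y) (tagged y)) (inp (tag y)).

Section Extension.

Variables (X : Type) (inp : X -> val) (T : X -> Type) (e : forall x, T x ->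
  val).

Lemma ptime_var : ptime (extend inp e) (fun y => e (tagged y)).
Proof. exact: ptime_fst (@ptime_id _ (extend inp e)). Qed.

Lemma ptime_weak f : ptime inp f -> ptime (extend inp e) (fun y => f (tag y)).
Proof.
move=> hf; apply: ptime_reindex hf _;
  exact: ptime_snd (@ptime_id _ (extend inp e)).
Qed.

End Extension.

Lemma size_enc_list_bound (T : Type) (f : T -> val) l K :
  (forall t, val_size (f t) <= K) ->
  val_size (enc_list (map f l)) <= 3 + size l * (K + 1).
Proof.
move=> hK; elim: l => [|t l IH] //=.
have := hK t; rewrite mulSn; lia.
Qed.

Lemma size_enc_list_ge (l : seq val) : size l <= val_size (enc_list l).
Proof. by elim: l => //= v l IH; lia. Qed.

(** Two lists carry two end markers [Num 0], each of size 3, and their concatenation only one. *)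
Lemma size_enc_list_cat l1 l2 :
  val_size (enc_list (l1 ++ l2)) + 3 =
  val_size (enc_list l1) + val_size (enc_list l2).
Proof.
by elim: l1 => [|v l IH]; rewrite /= ?cat0s; [rewrite addnC|lia].
Qed.

Lemma size_enc_list_rev l : val_size (enc_list (rev l)) = val_size (enc_list l).
Proof.
elim: l => //= v l IH; rewrite rev_cons -cats1.
have := size_enc_list_cat (rev l) [:: v]; rewrite IH /= .
have -> : rat_size 0 = 3 by []. lia.
Qed.

(** * Folds with accumulators of polynomial size *)

Section Fold.

Variables (X : Type) (inp : X -> val) (T A : X -> Type).
Variables (s : forall x, seq (T x)) (e : forall x, T x -> val).
Variables (a0 : forall x, A x) (ea : forall x, A x -> val).
Variable (step : forall x, A x -> T x -> A x).

Let fold_at x k := foldl (@step x) (a0 x) (take k (s x)).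

(* The bound [h] cannot be dropped: polynomial-time steps may double the size of
   the accumulator at each iteration. *)
Lemma ptime_fold (h : X -> nat) :
  ptime inp (fun x => enc_list (map (@e x) (s x))) ->
  ptime inp (fun x => ea (a0 x)) ->
  ptime (@extend _ inp (fun x => A x * T x)%type
           (fun x p => Pair (ea p.1) (e p.2)))
     (fun y => ea (step (tagged y).1 (tagged y).2)) ->
  poly_bounded (fun x => val_size (inp x)) h ->
  (forall x k, val_size (ea (fold_at x k)) <= h x) ->
  ptime inp (fun x => ea (foldl (@step x) (a0 x) (s x))).
Proof.
move=> hs ha hstep hpoly hsize r.
have [c1 [q1 h1]] := ha r.+1; have [c2 [q2 h2]] := hs r.+2.
have [c3 [q3 h3]] := hstep r.+3.
have [qL hL] := ptime_size hs.
pose body := Seq (Assign r.+3 (Bin MkPair (Bin MkPair (Var r.+1)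
    (Un Fst (Var r.+2))) (Var r)))
  (Seq c3 (Seq (Assign r.+1 (Var r.+3)) (Assign r.+2 (Un Snd (Var r.+2))))).
pose loop := While (Un IsPair (Var r.+2)) body.
pose L x := val_size (enc_list (map (@e x) (s x))).
(* [K] bounds one round: the step runs on accumulator, element and input joined by two [Pair] nodes,
   and the second summand generously covers the loop test and the assignments. *)
pose K x := q3.[2 + h x + L x + val_size (inp x)]%R
  + 20 * (h x + L x + val_size (inp x) + 1).
(* Loop invariant after [k] rounds, by induction on the unread part [l]. The extra [K x] in the time
   bound pays for the final failing test. *)
have hloop x l : forall k st, drop k (s x) = l ->
    st r = inp x -> st r.+1 = ea (fold_at x k) ->
    st r.+2 = enc_list (map (@e x) (drop k (s x))) ->
    val_size (enc_list (map (@e x) l)) <= L x ->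
    exists t st', [/\ exec loop st t st',
      st' r.+1 = ea (foldl (@step x) (a0 x) (s x)),
      forall y, y < r -> st' y = st y & t <= (size l).+1 * K x].
  elim: l => [|a l IH] k st dk sr sr1 sr2 sl.
    exists (eval_cost st (Un IsPair (Var r.+2))), st; split=> //.
    - by apply: ExecWhileStop; rewrite /= sr2 dk.
    - by rewrite sr1 /fold_at -[in RHS](cat_take_drop k (s x)) dk cats0.
    - by rewrite /= sr2 dk mul1n /K /=; change (rat_size 0) with 3; lia.
  rewrite dk /= in sr2; rewrite /= in sl.
  have ltk : k < size (s x).
    by rewrite ltnNge; apply/negP => /drop_oversize; rewrite dk.
  have fS : fold_at x k.+1 = step (fold_at x k) a.
    rewrite /fold_at (take_nth a) // -cats1 foldl_cat /=.
    by rewrite -[in nth _ _ k](addn0 k) -nth_drop dk.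
  have dS : drop k.+1 (s x) = l by rewrite -add1n -drop_drop dk /= drop0.
  pose y : {x & A x * T x}%type
    := Tagged (fun x => A x * T x)%type (fold_at x k, a).
  pose v := Pair (Pair (ea (fold_at x k)) (e a)) (inp x).
  have [|t3 [st3 [e3 r3 f3 le3]]] := h3 y (update st r.+3 v); first by upd.
  pose st4 := update (update st3 r.+1 (st3 r.+3)) r.+2 (enc_list (map (@e x)
    l)).
  have [||||t5 [st5 [e5 r5 f5 le5]]] := IH k.+1 st4 dS.
  - by rewrite /st4; upd; rewrite f3; [upd|lia].
  - by rewrite /st4; upd; rewrite r3 fS.
  - by rewrite /st4; upd; rewrite dS.
  - by lia.
  have s3r2 : st3 r.+2 = Pair (e a) (enc_list (map (@e x) l)).
    by rewrite f3; [upd|lia].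
  eexists; exists st5; split.
  - apply: (@ExecWhileStep _ body _ st4); [by rewrite /= sr2| |exact: e5].
    apply: ExecSeq; first exact: ExecAssign.
    rewrite /= sr sr1 sr2 -/v; apply: ExecSeq; first exact: e3.
    apply: ExecSeq; first exact: ExecAssign.
    have -> : st4 = update (update st3 r.+1 (eval st3 (Var r.+3))) r.+2
      (eval (update st3 r.+1 (eval st3 (Var r.+3))) (Un Snd (Var r.+2))).
      by rewrite /= update_neq ?s3r2 //; lia.
    exact: ExecAssign.
  - exact: r5.
  - by move=> z ltzr; rewrite f5 // /st4; upd; rewrite f3; [upd|lia].
  rewrite [size (a :: l)]/= mulSn -[K x]/(_ + _) /=.
  rewrite sr1 sr sr2 r3 /= update_neq ?s3r2 /=; last lia.
  have hk := hsize x k; have hk1 := hsize x k.+1.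
  rewrite fS in hk1; move: hk hk1 sl le3 le5; rewrite /extend /=.
  set aa := val_size (ea (fold_at x k)); set ab := val_size (ea (step _ _)).
  set el := val_size (enc_list _); set ee := val_size (e a).
  set ii := val_size (inp x) => hk hk1 sl le3 le5.
  have le3' : t3 <= q3.[2 + h x + L x + ii]%R.
    by apply: leq_trans le3 _; apply: horner_nat_mono; lia.
  have -> : rat_size 1 = 3 by [].
  move: le5; rewrite /K mulSn -/ii; lia.
have [q hq] : poly_bounded (fun x => val_size (inp x)) (fun x =>
  val_size (inp x) + q1.[val_size (inp x)]%R + val_size (inp x)
  + q2.[val_size (inp x)]%R
  + (qL.[val_size (inp x)]%R + 1) *
    (q3.[2 + h x + qL.[val_size (inp x)]%R + val_size (inp x)]%R
     + 20 * (h x + qL.[val_size (inp x)]%R + val_size (inp x) + 1)) + h x).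
  by polyb_tac.
exists (Seq (Assign r.+1 (Var r)) (Seq c1 (Seq (Assign r.+2 (Var r))
  (Seq c2 (Seq loop (Assign r (Var r.+1))))))), q => x st sr.
have [|t1 [s1 [e1 r1 f1 le1]]] := h1 x (update st r.+1 (inp x)); first by upd.
have s1r : s1 r = inp x by rewrite f1 //; upd.
have [|t2 [s2 [e2 r2 f2 le2]]] := h2 x (update s1 r.+2 (inp x)); first by upd.
have s2r : s2 r = inp x by rewrite f2; [upd|lia].
have [||||t3 [s3 [e3 r3 f3 le3]]] := hloop x (s x) 0 s2 _ s2r.
- by rewrite drop0.
- by rewrite f2 //; upd; rewrite r1 /fold_at take0.
- by rewrite r2 drop0.
- exact: leqnn.
eexists; eexists; split.
- apply: ExecSeq; first exact: ExecAssign.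
  rewrite /= sr; apply: ExecSeq; first exact: e1.
  apply: ExecSeq; first exact: ExecAssign.
  rewrite /= s1r; apply: ExecSeq; first exact: e2.
  apply: ExecSeq; first exact: e3.
  exact: ExecAssign.
- by upd.
- move=> y lty; upd; rewrite f3 // f2; [upd; rewrite f1; [upd|]|]; lia || done.
apply: leq_trans (hq x); rewrite /= sr s1r r3.
have := hsize x (size (s x)); rewrite /fold_at take_size => hfin.
have sL : size (s x) <= qL.[val_size (inp x)]%R.
  by apply: leq_trans (hL x); rewrite -(size_map (@e x));
    apply: size_enc_list_ge.
have : (size (s x)).+1 * K x <= (qL.[val_size (inp x)]%R + 1) *
    (q3.[2 + h x + qL.[val_size (inp x)]%R + val_size (inp x)]%R
     + 20 * (h x + qL.[val_size (inp x)]%R + val_size (inp x) + 1)).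
  apply: leq_mul; first by rewrite addn1.
  apply: leq_add; first by apply: horner_nat_mono; have := hL x; rewrite /L;
    lia.
  by rewrite leq_mul2l; have := hL x; rewrite /L; lia.
lia.
Qed.

End Fold.

(** * Encoded lists *)

Lemma foldl_select (T U : Type) (p : pred T) (f : T -> U) (a : seq U) l :
  foldl (fun acc t => if p t then f t :: acc else acc) a l
  = rev (map f (filter p l)) ++ a.
Proof.
elim: l a => [|t l IH] a //=; rewrite IH; case: (p t) => //=.
by rewrite rev_cons cat_rcons.
Qed.

Lemma size_enc_list_take l k :
  val_size (enc_list (take k l)) <= val_size (enc_list l).
Proof.
by have := size_enc_list_cat (take k l) (drop k l); rewrite cat_take_drop;
  have := val_size_ge3 (enc_list (drop k l)); lia.
Qed.

Lemma size_enc_list_select (T : Type) (e f : T -> val) (p : pred T) l L K :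
  (forall t, val_size (e t) <= L -> val_size (f t) <= K) ->
  val_size (enc_list (map e l)) <= L ->
  val_size (enc_list (map f (filter p l))) <= 3 + size l * (K + 1).
Proof.
move=> hf; elim: l => [|t l IH] //= hL.
have ht : val_size (f t) <= K by apply: hf; lia.
have := IH (leq_trans (leq_addl _ _) hL).
by case: (p t) => /=; rewrite mulSn; lia.
Qed.

Lemma size_enc_list_mem (T : eqType) (f : T -> val) l K :
  (forall t, t \in l -> val_size (f t) <= K) ->
  val_size (enc_list (map f l)) <= 3 + size l * (K + 1).
Proof.
elim: l => [|t l IH] //= hf; have := hf t (mem_head _ _).
have {IH} := IH (fun t' ht => hf t' (@mem_behead _ (t :: l) _ ht)).
by rewrite mulSn; lia.
Qed.

Section Lists.

Variables (X : Type) (inp : X -> val).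

Section Selection.

Variables (T : X -> Type) (s : forall x, seq (T x)) (e : forall x, T x -> val).
Hypothesis hs : ptime inp (fun x => enc_list (map (@e x) (s x))).

(** One fold filters and maps at once, but consing onto the accumulator reverses the order. Reversal
    is the special case of a true [p] and an identity [g], so a second pass restores the order. *)
Lemma ptime_rev_select (p : forall x, pred (T x)) (g : forall x, T x -> val) :
  ptime (extend inp e) (fun y => of_bool (p (tag y) (tagged y))) ->
  ptime (extend inp e) (fun y => g (tag y) (tagged y)) ->
  ptime inp (fun x => enc_list (rev (map (@g x) (filter (@p x) (s x))))).
Proof.
move=> hp hg.
have [qg hqg] := ptime_size hg; have [qs hqs] := ptime_size hs.
pose L x := qs.[val_size (inp x)]%R.
pose h x := 3 + L x * (qg.[1 + L x + val_size (inp x)]%R + 1).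
have := @ptime_fold X inp T (fun=> seq val) s e (fun=> [::]) (fun=> enc_list)
  (fun x acc t => if p x t then g x t :: acc else acc) h hs (ptime_num _ _).
move=> hfold; apply: ptime_ext (hfold _ _ _) => [x|||x k].
- by rewrite foldl_select cats0.
- set inp' := extend _ _.
  have h0 := @ptime_id _ inp'.
  (* Dropping the accumulator from the context makes [hp] and [hg] applicable. *)
  have hctx : ptime inp' (fun y => extend inp e (Tagged T (tagged y).2)).
    by apply: ptime_pair; [exact: ptime_snd (ptime_fst h0)|exact: ptime_snd h0].
  have ha : ptime inp' (fun y => enc_list (tagged y).1)
    by exact: ptime_fst (ptime_fst h0).
  apply: ptime_ext (ptime_if (ptime_reindex hp hctx)
    (ptime_pair (ptime_reindex hg hctx) ha) ha).
  by move=> y /=; case: (p _ _).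
- by rewrite /h /L; polyb_tac.
- rewrite foldl_select cats0 size_enc_list_rev.
  have le_sz : size (take k (s x)) <= L x.
    apply: leq_trans (hqs x); apply: leq_trans (size_enc_list_ge _).
    by rewrite size_map size_take_min geq_minr.
  apply: leq_trans (@size_enc_list_select _ (@e x) (@g x) _ _ (L x)
    (qg.[1 + L x + val_size (inp x)]%R) _ _) _.
  + move=> t ht; apply: leq_trans (hqg (Tagged T t)) _.
    by apply: horner_nat_mono; rewrite /extend /=; lia.
  + by rewrite map_take; apply: leq_trans (size_enc_list_take _ _) (hqs x).
  + by rewrite leq_add2l leq_mul2r le_sz orbT.
Qed.

End Selection.

Lemma ptime_rev (s : X -> seq val) : ptime inp (fun x => enc_list (s x)) ->
  ptime inp (fun x => enc_list (rev (s x))).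
Proof.
move=> hs.
have hs' : ptime inp (fun x => enc_list (map id (s x))).
  by apply: ptime_ext hs => x; rewrite map_id.
have := @ptime_rev_select (fun=> val) s (fun=> id) hs' (fun=> predT) (fun=> id)
  (ptime_bool _ true) (ptime_var _ _).
by apply: ptime_ext => x; rewrite filter_predT map_id.
Qed.

Section Transformation.

Variables (T : X -> Type) (s : forall x, seq (T x)) (e : forall x, T x -> val).
Hypothesis hs : ptime inp (fun x => enc_list (map (@e x) (s x))).

Lemma ptime_map (g : forall x, T x -> val) :
  ptime (extend inp e) (fun y => g (tag y) (tagged y)) ->
  ptime inp (fun x => enc_list (map (@g x) (s x))).
Proof.
move=> hg; have := ptime_rev (ptime_rev_select hs (p
  := fun=> predT) (ptime_bool _ true) hg).
by apply: ptime_ext => x; rewrite filter_predT revK.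
Qed.

Lemma ptime_filter (p : forall x, pred (T x)) :
  ptime (extend inp e) (fun y => of_bool (p (tag y) (tagged y))) ->
  ptime inp (fun x => enc_list (map (@e x) (filter (@p x) (s x)))).
Proof.
move=> hp; have := ptime_rev (ptime_rev_select hs hp (ptime_var _ _)).
by apply: ptime_ext => x; rewrite revK.
Qed.

(** The fold ignores the elements and carries a counter next to the list built so far. *)
Lemma ptime_iota :
  ptime inp (fun x => enc_list (map enc_nat (iota 0 (size (s x))))).
Proof.
pose ea (a : nat * seq val) := Pair (enc_nat a.1) (enc_list a.2).
pose step x (a : nat * seq val) (_ : T x) := (a.1.+1, enc_nat a.1 :: a.2).
have fE x l a : foldl (@step x) a l
    = (a.1 + size l, rev (map enc_nat (iota a.1 (size l))) ++ a.2).
  elim: l a => [|t l IH] [k a] /=; first by rewrite addn0.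
  by rewrite IH /= addSnnS rev_cons cat_rcons.
have [qs hqs] := ptime_size hs.
pose L x := qs.[val_size (inp x)]%R.
pose h x := 1 + (L x + 3) + (3 + L x * (L x + 3 + 1)).
have := @ptime_fold X inp T (fun=> nat * seq val)%type s e (fun=> (0, [::]))
  (fun=> ea) step h hs (ptime_pair (ptime_num _ _) (ptime_num _ _)).
move=> hfold; have {hfold} := ptime_rev (ptime_ext (g := fun x => enc_list
  (rev (map enc_nat (iota 0 (size (s x)))))) _ (ptime_snd (hfold _ _ _))).
move=> H; apply: ptime_ext (H _ _ _ _) => [x|x|||x k].
- by rewrite revK.
- by rewrite fE cats0.
- set inp' := extend _ _.
  have h0 := @ptime_id _ inp'.
  have h1 : ptime inp' (fun y => enc_nat (tagged y).1.1).
    by exact: ptime_fst (ptime_fst (ptime_fst h0)).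
  apply: ptime_pair; last by apply: ptime_pair h1 _;
    exact: ptime_snd (ptime_fst (ptime_fst h0)).
  by apply: ptime_ext (ptime_addn h1 (ptime_num _ 1%:R%R)) => y; rewrite addn1.
- by rewrite /h /L; polyb_tac.
- have le_sz : size (take k (s x)) <= L x.
    apply: leq_trans (hqs x); apply: leq_trans (size_enc_list_ge _).
    by rewrite size_map size_take_min geq_minr.
  rewrite fE cats0 /= add0n size_enc_list_rev; apply: leq_add.
    by rewrite leq_add2l; apply: leq_trans (size_enc_nat _) _;
      rewrite leq_add2r.
  apply: leq_trans (_ : 3 + size (take k (s x)) * (L x + 3 + 1) <= _).
    rewrite -[in leqRHS](size_iota 0 (size (take k (s x)))).
    apply: size_enc_list_mem => i; rewrite mem_iota /= => lt_i.
    by apply: leq_trans (size_enc_nat _) _; lia.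
  by rewrite leq_add2l leq_mul2r le_sz orbT.
Qed.

(** The fold runs over the first encoding while its accumulator carries the unread part of the
    second. *)
Lemma ptime_zip (e' : forall x, T x -> val) :
  ptime inp (fun x => enc_list (map (@e' x) (s x))) ->
  ptime inp (fun x => enc_list (map (fun t => Pair (e t) (e' x t)) (s x))).
Proof.
move=> hs'.
pose ea (a : seq val * seq val) := Pair (enc_list a.1) (enc_list a.2).
(* The step has to be computed on all accumulators, also on those that never arise: the defaults of
   [behead] and [head] agree with [Snd] and [Fst] on the empty list [Num 0]. *)
pose step x (a : seq val * seq val) (t : T x) :=
  (behead a.1, Pair (e t) (head (Defs.Num 0%R) a.1) :: a.2).
have fE x (l : seq (T x)) a l' : foldl (@step x) (map (@e' x) l ++ l', a) l
    = (l', rev (map (fun t => Pair (e t) (e' x t)) l) ++ a).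
  by elim: l a => [|t l IH] a //=; rewrite /step /= IH rev_cons cat_rcons.
have [qs hqs] := ptime_size hs; have [qs' hqs'] := ptime_size hs'.
pose L x := qs.[val_size (inp x)]%R; pose L' x := qs'.[val_size (inp x)]%R.
pose h x := 1 + L' x + (L x + L' x + L x).
have szE x (l : seq (T x)) : val_size (enc_list (map (fun t => Pair (e t)
  (e' x t)) l))
    <= val_size (enc_list (map (@e x) l)) + val_size (enc_list (map (@e' x) l))
      + size l.
  by elim: l => [|t l IH] //=; lia.
have := @ptime_fold X inp T (fun=> seq val * seq val)%type s e
  (fun x => (map (@e' x) (s x), [::]))
  (fun=> ea) step h hs (ptime_pair hs' (ptime_num _ _)).
move=> hfold; have {hfold} := ptime_rev (ptime_ext (g := fun x => enc_list
  (rev (map (fun t => Pair (e t) (e' x t)) (s x))))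
    _ (ptime_snd (hfold _ _ _))).
move=> H; apply: ptime_ext (H _ _ _ _) => [x|x|||x k].
- by rewrite revK.
- by rewrite -[map (@e' x) _]cats0 fE cats0.
- set inp' := extend _ _.
  have h0 := @ptime_id _ inp'.
  have h1 : ptime inp' (fun y => enc_list (tagged y).1.1).
    by exact: ptime_fst (ptime_fst (ptime_fst h0)).
  have h2 : ptime inp' (fun y => enc_list (tagged y).1.2).
    by exact: ptime_snd (ptime_fst (ptime_fst h0)).
  have h3 : ptime inp' (fun y => e (tagged y).2)
    by exact: ptime_snd (ptime_fst h0).
  apply: ptime_pair; first by apply: ptime_ext (ptime_snd h1)
    => -[x [[[|v l] a] t]].
  apply: ptime_pair h2; apply: ptime_pair h3 _.
  by apply: ptime_ext (ptime_fst h1) => -[x [[[|v l] a] t]].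
- by rewrite /h /L /L'; polyb_tac.
- rewrite -{1}(cat_take_drop k (s x)) map_cat fE cats0 /= size_enc_list_rev.
  have := szE x (take k (s x)); have := hqs x; have := hqs' x.
  have := size_enc_list_cat (map (@e' x) (take k (s x))) (map (@e' x)
    (drop k (s x))).
  have := size_enc_list_cat (map (@e x) (take k (s x))) (map (@e x)
    (drop k (s x))).
  have := size_enc_list_ge (map (@e x) (take k (s x))).
  rewrite -!map_cat cat_take_drop size_map /h /L /L'.
  have := val_size_ge3 (enc_list (map (@e x) (drop k (s x)))).
  have := val_size_ge3 (enc_list (map (@e' x) (take k (s x)))).
  have := val_size_ge3 (enc_list (map (@e' x) (drop k (s x)))).
  lia.
Qed.

End Transformation.

Lemma ptime_cat (s1 s2 : X -> seq val) : ptime inp (fun x => enc_list (s1 x)) ->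
  ptime inp (fun x => enc_list (s2 x)) ->
    ptime inp (fun x => enc_list (s1 x ++ s2 x)).
Proof.
move=> hs1 hs2; have hr := ptime_rev hs1.
have [q1 hq1] := ptime_size hr; have [q2 hq2] := ptime_size hs2.
pose h x := q1.[val_size (inp x)]%R + q2.[val_size (inp x)]%R.
have fE (a : seq val) l : foldl (fun acc t => t :: acc) a l = rev l ++ a.
  have := @foldl_select _ _ predT id a l.
  by rewrite filter_predT map_id.
have hr' : ptime inp (fun x => enc_list (map id (rev (s1 x)))).
  by apply: ptime_ext hr => x; rewrite map_id.
have := @ptime_fold X inp (fun=> val) (fun=> seq val) _ (fun=> id) s2
  (fun=> enc_list) (fun x acc t => t :: acc) h hr' hs2.
move=> hfold; apply: ptime_ext (hfold _ _ _) => [x|||x k].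
- by rewrite fE revK.
- set inp' := extend _ _.
  have h0 := @ptime_id _ inp'.
  by apply: ptime_pair; [exact: ptime_snd (ptime_fst h0)|exact: ptime_fst
    (ptime_fst h0)].
- by rewrite /h; polyb_tac.
- rewrite fE; have := size_enc_list_cat (rev (take k (rev (s1 x)))) (s2 x).
  rewrite size_enc_list_rev; have := size_enc_list_take (rev (s1 x)) k.
  by have := hq1 x; have := hq2 x; rewrite /h; lia.
Qed.

(** Search in an association list with default [d], where the last match wins. The accumulator is
    always the default or a listed value, hence small. *)
Lemma ptime_lookup (T : X -> Type) (s : forall x, seq (T x))
    (key : forall x, T x -> nat) (v : forall x, T x -> val)
    (k : X -> nat) (d : X -> val) :
  ptime inp (fun x => enc_list (map (fun t => Pair (enc_nat (key x t)) (v x t))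
    (s x))) ->
  ptime inp (fun x => enc_nat (k x)) -> ptime inp d ->
  ptime inp (fun x =>
    foldl (fun a t => if key x t == k x then v x t else a) (d x) (s x)).
Proof.
move=> hs hk hd.
have [qs hqs] := ptime_size hs; have [qd hqd] := ptime_size hd.
pose h x := qs.[val_size (inp x)]%R + qd.[val_size (inp x)]%R.
apply: (@ptime_fold X inp T (fun=> val) s
  (fun x t => Pair (enc_nat (key x t)) (v x t)) d (fun=> id)
  (fun x a t => if key x t == k x then v x t else a) h hs hd).
- set inp' := extend _ _.
  have h0 := @ptime_id _ inp'.
  have hk' : ptime inp' (fun y => enc_nat (k (tag y))).
    exact: ptime_reindex hk (ptime_snd h0).
  apply: ptime_if; first apply: ptime_eqn hk'.
  + exact: ptime_fst (ptime_snd (ptime_fst h0)).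
  + exact: ptime_snd (ptime_snd (ptime_fst h0)).
  + exact: ptime_fst (ptime_fst h0).
- by rewrite /h; polyb_tac.
- move=> x j.
  have hL : val_size (enc_list (map (fun t => Pair (enc_nat (key x t)) (v x t))
      (take j (s x)))) <= qs.[val_size (inp x)]%R.
    by rewrite map_take; apply: leq_trans (size_enc_list_take _ _) (hqs x).
  have hD := hqd x; rewrite -/(h x).
  have : val_size (d x) <= h x by rewrite /h; lia.
  elim: (take _ _) (d x) hL {hD} => [|t l IH] a //= hL ha.
  apply: IH; first lia.
  by case: ifP => // _; rewrite /h; lia.
Qed.

End Lists.

(** * The reduction *)

Lemma split_lshift m n (i : 'I_m) : split (lshift n i) = inl i.
Proof. exact: (unsplitK (inl i)). Qed.

Lemma split_rshift m n (i : 'I_n) : split (rshift m i) = inr i.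
Proof. exact: (unsplitK (inr i)). Qed.

Definition splitE := (split_lshift, split_rshift).

Section Reduction.

Local Open Scope ring_scope.

Variable I : cpfl_instance.
Local Notation n := (npoints I).
Implicit Types (j x y z : 'I_n).

(** * The CFL instance with dummy facilities *)

Definition charged : {set 'I_n} := [set j in clients I | 0 < penalty j].

(** Every point receives a dummy, so that the new points are simply ['I_(n + n)]. The dummy of an
    uncharged point is no facility, and any positive length would do for it. *)
Definition weight j : rat := if j \in charged then penalty j else 1.

Lemma weight_gt0 j : 0 < weight j.
Proof.
by rewrite /weight; case: ifP => //; rewrite inE => /andP[].
Qed.

Lemma weight_charged j : j \in charged -> weight j = penalty j.
Proof. by rewrite /weight => ->. Qed.

(** The shortest-path distance once the pendant edges are attached: [lshift] gives the original
    points, [rshift] the far ends. *)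
Definition pendant_dist (u v : 'I_(n + n)) : rat :=
  match split u, split v with
  | inl x, inl y => dist x y
  | inl x, inr y => dist x y + weight y
  | inr x, inl y => dist x y + weight x
  | inr x, inr y => if x == y then 0 else dist x y + weight y + weight x
  end.

Lemma pendant_dist_metric : is_metric pendant_dist.
Proof.
have [d0 d_eq d_sym d_tri] := dist_metric I.
have w0 x := ltW (weight_gt0 x); have w1 := weight_gt0.
have dxx x : dist x x = 0 by apply/d_eq.
split.
- move=> u v; rewrite /pendant_dist.
  case: (split u) (split v) => [x|x] [y|y]; rewrite ?addr_ge0 //.
  by case: ifP => // _; rewrite !addr_ge0.
- move=> u v; case: (split_ordP u) => x ->; case: (split_ordP v) => y ->;
    rewrite /pendant_dist !splitE.
  + by split=> [/d_eq->|/lshift_inj->].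
  + split; first by move=> h; exfalso; move: h; have := d0 x y; have := w1 y;
    lra.
    by move/eqP; rewrite eq_lrshift.
  + split; first by move=> h; exfalso; move: h; have := d0 x y; have := w1 x;
    lra.
    by move/eqP; rewrite eq_rlshift.
  + case: eqP => [->|ne_xy]; first by split.
    split; first by move=> h; exfalso; move: h; have := d0 x y; have := w1 x;
      have := w1 y; lra.
    by move/rshift_inj.
- move=> u v; rewrite /pendant_dist.
  case: (split u) (split v) => [x|x] [y|y]; rewrite (d_sym x y) //.
  by rewrite eq_sym; case: ifP => // _; rewrite addrAC.
- move=> u v t; rewrite /pendant_dist.
  case: (split u) (split v) (split t) => [x|x] [y|y] [z|z];
    have := d_tri x y z; have := w1 x; have := w1 y; have := w1 z;
    have := d0 x y; have := d0 y z; have := d0 x z;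
    do ?[case: eqP => [?|?]]; subst; rewrite ?dxx; try lra; try by [].

Qed.

Definition red_facilities : {set 'I_(n + n)} :=
  [set u | match split u with inl x => x \in facilities I | inr x => x \in
    charged end].

Definition red_clients : {set 'I_(n + n)} :=
  [set u | match split u with inl x => x \in charged | inr _ => false end].

Definition red_opening (u : 'I_(n + n)) : rat :=
  if split u is inl x then opening x else 0.

Definition red_capacity (u : 'I_(n + n)) : nat :=
  if split u is inl x then capacity x else 1%N.

Lemma red_opening_ge0 u : u \in red_facilities -> 0 <= red_opening u.
Proof.
rewrite inE /red_opening; case: (split u) => // x; exact: opening_ge0.
Qed.

Definition reduction : cfl_instance :=
  @CFLInstance _ pendant_dist pendant_dist_metric red_facilities red_clients
    red_opening red_opening_ge0 red_capacity.

Lemma red_clientsE : red_clients = [set lshift n j | j in charged].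
Proof.
apply/setP => u; rewrite [u \in red_clients]inE; case: (split_ordP u) => x ->.
  by rewrite mem_imset //; apply: lshift_inj.
by symmetry; apply/imsetP => -[y _ /eqP]; rewrite eq_rlshift.
Qed.

Lemma mem_red_clients j : (lshift n j \in red_clients) = (j \in charged).
Proof. by rewrite [LHS]inE splitE. Qed.

(** * Moving clients to their own dummies *)

Section Swap.

Variable op : {set 'I_(n + n)}.
Implicit Type b : 'I_(n + n) -> 'I_(n + n).

(* Membership in [charged] makes [swap] computable for every [j], not only for
   those in the encoded list. *)
Definition dummy_used b j : bool :=
  (j \in charged) && [exists u in red_clients, b u == rshift n j].

(** The client occupying the dummy of [j] is recognised by its assignment instead of being named;
    capacity 1 makes it unique when [b] is valid. *)
Definition swap b j : 'I_(n + n) -> 'I_(n + n) := fun u =>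
  if dummy_used b j then
    if b u == rshift n j then b (lshift n j)
    else if u == lshift n j then rshift n j else b u
  else b u.

Definition valid b := @serves reduction red_clients (CFLSolution (I
  := reduction) op b).
Definition cost_of b := @service_cost reduction red_clients (CFLSolution (I
  := reduction) op b).

Lemma dummy_user_unique b j u v : valid b ->
  u \in red_clients -> v \in red_clients ->
  b u = rshift n j -> b v = rshift n j -> u = v.
Proof.
move=> [_ /= hop hcap] uC vC bu bv.
have : rshift n j \in op by rewrite -bu; apply: hop.
move=> /hcap /=; rewrite /red_capacity splitE => le1.
by apply: (card_le1_eqP le1); rewrite inE ?uC ?vC /= ?bu ?bv eqxx.
Qed.

(** A nontrivial swap is precomposition with a transposition of two clients. This holds on clients
    only: a point that is no client may also be mapped to the dummy. *)
Lemma swapE b j : valid b -> j \in charged ->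
  (forall u, swap b j u = b u) \/
  exists2 k, k \in charged & b (lshift n k) = rshift n j /\
    {in red_clients, forall u,
      swap b j u = b (tperm (lshift n k) (lshift n j) u)}.
Proof.
move=> hb jQ; rewrite /swap; case: (boolP (dummy_used b j)) => [|_];
  last by left.
move=> /andP[_ /exists_inP[u uC /eqP bu]].
right; have := uC; rewrite {1}red_clientsE => /imsetP[k kQ ek].
exists k => //; rewrite -ek; split=> // v vC.
have jC : lshift n j \in red_clients by rewrite mem_red_clients.
case: tpermP => [->|->|/eqP nvu /eqP nvj].
- by rewrite bu eqxx.
- case: eqP => [bj|_]; last by rewrite eqxx.
  by rewrite bu bj.
- case: eqP => [bv|_]; last by rewrite (negPf nvj).
  by rewrite (dummy_user_unique hb vC uC bv bu) eqxx in nvu.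
Qed.

Lemma tperm_red_clients j k u : j \in charged -> k \in charged ->
  (tperm (lshift n k) (lshift n j) u \in red_clients) = (u \in red_clients).
Proof.
by move=> jQ kQ; case: tpermP => [->|->|//]; rewrite !mem_red_clients jQ kQ.
Qed.

Lemma eq_valid b b' : {in red_clients, b =1 b'} -> valid b -> valid b'.
Proof.
move=> eb [h1 h2 h3]; split=> //= [u uC|i iop]; first by rewrite -eb //;
  apply: h2.
apply: leq_trans (h3 i iop) => /=; apply: subset_leq_card; apply/subsetP => u.
by rewrite !inE => /andP[uC]; rewrite uC -eb // ?inE.
Qed.

(** Precomposition with a permutation that preserves the clients turns each fibre into its preimage,
    which has the same size. *)
Lemma swap_valid b j : valid b -> j \in charged -> valid (swap b j).
Proof.
move=> hb jQ; have [eb|[k kQ [bk eb]]] := swapE hb jQ.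
  by apply: eq_valid hb => u _; rewrite eb.
pose p := tperm (lshift n k) (lshift n j).
apply: (@eq_valid (fun u => b (p u))) => [u uC|]; first by rewrite eb.
have [h1 h2 h3] := hb; split=> //= [u uC|i iop].
  by apply: h2; rewrite tperm_red_clients.
apply: leq_trans (h3 i iop) => /=.
rewrite -(card_preimset _ (@perm_inj _ p)); apply: subset_leq_card.
apply/subsetP => u; have := tperm_red_clients u jQ kQ.
by rewrite !in_set => ->; rewrite tpermK.
Qed.

Lemma pendant_dist_ll x y : pendant_dist (lshift n x) (lshift n y) = dist x y.
Proof. by rewrite /pendant_dist !splitE. Qed.

Lemma pendant_dist_lr x y :
  pendant_dist (lshift n x) (rshift n y) = dist x y + weight y.
Proof. by rewrite /pendant_dist !splitE. Qed.

Lemma distxx x : dist x x = 0.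
Proof. by have [_ d_eq _ _] := dist_metric I; apply/d_eq. Qed.

Lemma eq_cost b b' : {in red_clients, b =1 b'} -> cost_of b = cost_of b'.
Proof.
move=> eb; rewrite /cost_of /service_cost /=; congr (_ + _).
by apply: eq_bigr => u uC; rewrite eb.
Qed.

(** Only the terms of [k] and [j] change. Before, they are [dist k j + weight j] and the distance
    from [j] to [b j]; afterwards, the distance from [k] to [b j] and [weight j]. The triangle
    inequality through [j] compares them. *)
Lemma swap_cost b j : valid b -> j \in charged ->
  cost_of (swap b j) <= cost_of b.
Proof.
move=> hb jQ; have [eb|[k kQ [bk eb]]] := swapE hb jQ.
  by rewrite (@eq_cost _ b) // => u _.
rewrite (eq_cost eb) /cost_of /service_cost /= lerD2l.
have kC : lshift n k \in red_clients by rewrite mem_red_clients.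
have jC : lshift n j \in red_clients by rewrite mem_red_clients.
have [->|ne_kj] := eqVneq k j.
  by rewrite tperm1 le_eqVlt; apply/orP; left; apply/eqP; apply: eq_bigr => u _;
    rewrite perm1.
have ne : lshift n j != lshift n k by rewrite (inj_eq (@lshift_inj _ _)) eq_sym.
rewrite (bigD1 (lshift n k)) //= [leRHS](bigD1 (lshift n k)) //=.
rewrite (bigD1 (lshift n j)) ?jC //= [X in _ <= _ + X](bigD1 (lshift n j))
  ?jC //=.
rewrite tpermL tpermR bk !pendant_dist_lr distxx add0r.
rewrite !addrA lerD //; last first.
  apply: ler_sum => u /andP[/andP[_ uk] uj].
  by rewrite tpermD // eq_sym.
have [_ _ d_sym d_tri] := pendant_dist_metric.
have := d_tri (lshift n k) (lshift n j) (b (lshift n j)).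
by rewrite pendant_dist_ll; lra.
Qed.

(** With capacity 1, this leaves [j] as the only possible user of its dummy. *)
Definition settled b j : Prop :=
  {in red_clients, forall u, b u = rshift n j -> b (lshift n j) = rshift n j}.

Lemma swap_settled b j : valid b -> j \in charged -> settled (swap b j) j.
Proof.
move=> hb jQ u uC; rewrite /swap; case: (boolP (dummy_used b j)) => [_|].
  by rewrite eqxx => _; case: (b (lshift n j) =P _).
by rewrite /dummy_used jQ => /exists_inP nu bu; case: nu; exists u; rewrite ?bu.
Qed.

(** A swap only permutes the assignments of clients, so a dummy of [m] in use afterwards was in use
    before, hence by [m] itself; and the swap for another [j] does not move [m]. *)
Lemma swap_keeps_settled b j m : valid b -> j \in charged ->
  settled b m -> settled (swap b j) m.
Proof.
move=> hb jQ hm; have [->|ne_mj] := eqVneq m j; first exact: swap_settled.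
move=> u uC su.
have [v vC bv] : exists2 v, v \in red_clients & b v = rshift n m.
  have [eb|[k kQ [_ eb]]] := swapE hb jQ; first by exists u; rewrite // -eb.
  exists (tperm (lshift n k) (lshift n j) u); last by rewrite -eb.
  by rewrite tperm_red_clients.
rewrite /swap (hm v vC bv) (inj_eq (@rshift_inj _ _))
  (inj_eq (@lshift_inj _ _)).
by rewrite (negPf ne_mj) if_same.
Qed.

Definition settle b : 'I_(n + n) -> 'I_(n + n) := foldl swap b (enum charged).

Lemma settleP b : valid b -> [/\ valid (settle b),
  cost_of (settle b) <= cost_of b
  & forall j, j \in charged -> settled (settle b) j].
Proof.
move=> hb.
(* The disjunction strengthens the induction: it covers both the clients still to be treated and
   those already settled. *)
have [h1 h2 h3] : [/\ valid (settle b), cost_of (settle b) <= cost_of b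
  & forall j, (j \in enum charged) \/ settled b j -> settled (settle b) j].
  rewrite /settle; have : {subset enum charged <= charged}.
    by move=> j; rewrite mem_enum.
  elim: (enum charged) b hb => [|j l IH] b hb sub /=.
    by split=> // j []; rewrite ?in_nil.
  have jQ : j \in charged by apply: sub; rewrite mem_head.
  have [||v c st] := IH (swap b j); first exact: swap_valid.
    by move=> i il; apply: sub; rewrite inE il orbT.
  split=> // [|m hm]; first exact: le_trans c (swap_cost hb jQ).
  apply: st; case: hm => [|hm]; last by right; apply: swap_keeps_settled.
  rewrite inE => /orP[/eqP->|->]; [right; exact: swap_settled|by left].
by split=> // j jQ; apply: h3; left; rewrite mem_enum.
Qed.

End Swap.

(** * Converting solutions in both directions *)

Definition unreduce (s : cfl_solution reduction) : cpfl_solution I :=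
  let b : 'I_(n + n) -> 'I_(n + n) := settle (assigned s) in
  @CPFLSolution I
    (@CFLSolution I [set i | lshift n i \in opened s]
      (fun j => if split (b (lshift n j)) is inl i then i else j))
    [set j in clients I | ~~ (0 < penalty j) || (n <= b (lshift n j))%N].

Lemma sum_red_opening (op : {set 'I_(n + n)}) :
  \sum_(u in op) red_opening u = \sum_(i | lshift n i \in op) opening i.
Proof.
rewrite big_split_ord /= [X in _ + X]big1 ?addr0; last first.
  by move=> j _; rewrite /red_opening splitE.
by apply: eq_bigr => j _; rewrite /red_opening splitE.
Qed.

Lemma sum_red_clients (F : 'I_(n + n) -> rat) :
  \sum_(u in red_clients) F u = \sum_(j in charged) F (lshift n j).
Proof.
rewrite big_split_ord /= [X in _ + X]big1 ?addr0; last first.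
  by move=> j; rewrite inE splitE.
by apply: eq_bigl => j; rewrite mem_red_clients.
Qed.

(** Clients of penalty 0 all pay, and so do those settled at a dummy. A served client is therefore
    settled at an original point, and the fallback [j] in [unreduce] never matters for it. *)
Lemma served_unreduce (s : cfl_solution reduction) j :
  (j \in served (unreduce s)) =
  (j \in charged) && (settle (assigned s) (lshift n j) < n)%N.
Proof.
rewrite /served in_setD !in_set /= negb_and negb_or negbK -ltnNge.
by case: (j \in clients I); rewrite ?andbF //= andbT.
Qed.

Lemma unreduce_feasible (s : cfl_solution reduction) :
  cfl_feasible s -> cpfl_feasible (unreduce s).
Proof.
case: s => op a hs; have [] : valid op (settle a) by have [] := settleP hs.
set b := settle a => /= hop hasg hcap; split.
  by apply/subsetP => j; rewrite inE => /andP[].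
have bE j : j \in served (unreduce (@CFLSolution reduction op a)) ->
    b (lshift n j) = lshift n (assigned (unreduce (@CFLSolution reduction op a))
      j).
  rewrite served_unreduce /= -/b => /andP[_].
  by case: (split_ordP (b (lshift n j))) => i -> //=; lia.
split=> /= [|j js|i].
- by apply/subsetP => i; rewrite inE => /(subsetP hop); rewrite inE splitE.
- rewrite inE -bE //; apply: hasg.
  by rewrite mem_red_clients; move: js; rewrite served_unreduce => /andP[].
- rewrite inE => /hcap; rewrite /red_capacity splitE; apply: leq_trans.
  rewrite -(card_imset _ (@lshift_inj n n)); apply: subset_leq_card.
  apply/subsetP => u /imsetP[j]; rewrite in_set => /andP[js /eqP ji] ->.
  rewrite in_set mem_red_clients bE // /= -ji eqxx andbT.
  by move: js; rewrite served_unreduce => /andP[].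
Qed.

(** After settling, the charged clients split into those at original points, whose distances are
    unchanged, and those at dummies, where each is at its own and costs exactly its penalty. *)
Lemma unreduce_cost (s : cfl_solution reduction) :
  cfl_feasible s -> cpfl_cost (unreduce s) <= cfl_cost s.
Proof.
case: s => op a hs; have [hv hc hst] := settleP hs.
apply: le_trans hc; rewrite /cpfl_cost /cost_of /service_cost /=.
set b := settle a in hv hst *; rewrite sum_red_opening -addrA.
have [_ /= hasg _] := hv.
rewrite (eq_bigl (fun i => lshift n i \in op)) => [|i]; last by rewrite inE.
rewrite lerD2l sum_red_clients.
rewrite [leRHS](bigID (fun j => (b (lshift n j) < n)%N)) /=.
rewrite (eq_bigl (fun j => (j \in charged) && (b (lshift n j) < n)%N));
  last first.
  by move=> j; rewrite served_unreduce.
apply: lerD.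
  apply: ler_sum => j /andP[_]; case: (split_ordP (b (lshift n j))) => i -> /=.
    by rewrite pendant_dist_ll.
  by lia.
(* The paying clients that were dropped from the reduction contribute penalty 0. *)
rewrite (bigID (fun j => 0 < penalty j)) /= [X in _ + X <= _]big1 ?addr0;
  last first.
  move=> j; rewrite inE => /andP[/andP[jC _] np]; apply/eqP.
  by rewrite eq_le leNgt np penalty_ge0.
rewrite (eq_bigl (fun j => (j \in charged) && ~~ (b (lshift n j) < n)%N));
  last first.
  move=> j; rewrite !inE -leqNgt; case: (0 < penalty j); rewrite ?andbF //=.
  by rewrite !andbT.
apply: ler_sum => j /andP[jQ]; have jC : lshift n j \in red_clients.
  by rewrite mem_red_clients.
case: (split_ordP (b (lshift n j))) => m bj; rewrite bj /=; first by lia.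
have mQ : m \in charged.
  have := hasg _ jC; rewrite bj; have [hop _ _] := hv.
  by move=> /(subsetP hop); rewrite inE splitE.
(* The dummy of [m] is used by [j], hence also by [m], and capacity 1 forces [j = m]. *)
move=> _; have := dummy_user_unique hv jC _ bj (hst m mQ _ jC bj).
rewrite mem_red_clients => /(_ mQ) /lshift_inj ejm; rewrite -ejm.
by rewrite pendant_dist_lr distxx add0r weight_charged.
Qed.

Definition embed (s : cpfl_solution I) : cfl_solution reduction :=
  @CFLSolution reduction
    [set u : 'I_(n + n) | match split u with
      | inl i => i \in opened s | inr j => (j \in charged) &&
        (j \in paying s) end]
    (fun u : 'I_(n + n) => match split u with
      | inl j => if j \in paying s then rshift n j else lshift n (assigned s j)
      | inr _ => u end).

Lemma embed_feasible s : cpfl_feasible s -> cfl_feasible (embed s).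
Proof.
move=> [hpay [hop hasg hcap]]; have served_charged j :
    j \in charged -> j \notin paying s -> j \in served s.
  by rewrite !inE => /andP[-> _] ->.
split=> /= [|u|u].
- apply/subsetP => u; rewrite !inE; case: (split u) => [i /(subsetP hop)|j] //.
  by move=> /andP[].
- rewrite red_clientsE => /imsetP[j jQ ->]; rewrite splitE inE.
  by case: ifP => jp; rewrite splitE ?jQ ?hasg ?served_charged ?jp.
- rewrite inE; case: (split_ordP u) => i -> /= hi; rewrite /red_capacity splitE.
  + apply: leq_trans (hcap i hi); rewrite -(card_imset _ (@lshift_inj n n)).
    apply: subset_leq_card; apply/subsetP => v; rewrite in_set => /andP[].
    rewrite red_clientsE => /imsetP[j jQ ->]; rewrite splitE.
    case: ifPn => jp; first by rewrite eq_rlshift.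
    rewrite (inj_eq (@lshift_inj _ _)) => ji; apply: imset_f.
    by rewrite in_set ji served_charged.
  + rewrite -(cards1 (lshift n i)); apply: subset_leq_card; apply/subsetP => v.
    rewrite in_set => /andP[]; rewrite red_clientsE => /imsetP[j jQ ->].
    rewrite splitE; case: ifPn => jp; last by rewrite eq_lrshift.
    by rewrite (inj_eq (@rshift_inj _ _)) => /eqP->; rewrite inE.
Qed.

(** Charged clients cost the same on both sides. The inequality comes from uncharged clients, whose
    nonnegative costs disappear. *)
Lemma embed_cost s : cpfl_feasible s -> cfl_cost (embed s) <= cpfl_cost s.
Proof.
move=> [/subsetP hpay _]; rewrite /cpfl_cost /cfl_cost /service_cost /=.
rewrite sum_red_opening -addrA (eq_bigl (fun i => i \in opened s)); last first.
  by move=> i; rewrite inE splitE.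
have [d0 _ _ _] := dist_metric I.
rewrite lerD2l sum_red_clients (bigID (fun j => j \in paying s)) /= addrC.
apply: lerD.
  rewrite [leRHS](bigID (fun j => j \in charged)) /=.
  rewrite -[leLHS]addr0; apply: lerD; last by apply: sumr_ge0.
  rewrite le_eqVlt; apply/orP; left; apply/eqP; apply: eq_big => j.
    rewrite !inE; case: (j \in clients I) (j \in paying s) (0 < penalty j)
      => [] [] [] //=.
  by move=> /andP[_ /negPf jp]; rewrite splitE jp pendant_dist_ll.
rewrite [leRHS](bigID (fun j => j \in charged)) /=.
rewrite -[leLHS]addr0; apply: lerD; last first.
  by apply: sumr_ge0 => j /andP[/hpay jC _]; apply: penalty_ge0.
rewrite le_eqVlt; apply/orP; left; apply/eqP; apply: eq_big => [j|j].
  by rewrite andbC.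
move=> /andP[jQ jp]; rewrite splitE jp pendant_dist_lr distxx add0r.
exact: weight_charged.
Qed.

(** Any feasible [s'] of the reduction costs at least [unreduce s'], hence at least [s], hence at
    least [embed s]. *)
Lemma embed_optimal s : @optimal CPFL I s -> @optimal CFL reduction (embed s) /\
  cfl_cost (embed s) = cpfl_cost s.
Proof.
move=> [fs os]; have fe := embed_feasible fs; have ce := embed_cost fs.
have lower (s' : cfl_solution reduction) : cfl_feasible s' ->
  cpfl_cost s <= cfl_cost s'.
  move=> fs'; have le_s : cpfl_cost s <= cpfl_cost (unreduce s').
    exact: os _ (unreduce_feasible fs').
  exact: le_trans le_s (unreduce_cost fs').
split; last by apply/eqP; rewrite eq_le ce lower.
by split=> // s' fs'; exact: le_trans ce (lower s' fs').
Qed.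

(** It is feasible that all clients pay, and up to extensional equality of assignments there are
    finitely many solutions. Through [embed_optimal] the reduction then has an optimum, without
    which the output of the CFL program would be unconstrained. *)
Lemma cpfl_optimum_exists : exists s : cpfl_solution I, @optimal CPFL I s.
Proof.
pose sol (t : {set 'I_n} * {ffun 'I_n ->
  'I_n} * {set 'I_n}) : cpfl_solution I :=
  CPFLSolution (@CFLSolution I t.1.1 t.1.2) t.2.
pose code (s : cpfl_solution I) := (opened s, [ffun j => assigned s j],
  paying s).
have code_feasible s : cpfl_feasible s -> cpfl_feasible (sol (code s)).
  case: s => [[op a] py] [hp [h1 h2 h3]]; split=> //; split=> //= [j js|i iop].
    by rewrite ffunE; apply: h2.
  apply: leq_trans (h3 i iop); apply: subset_leq_card; apply/subsetP => j.
  by rewrite !in_set /= ffunE.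
have code_cost s : cpfl_cost (sol (code s)) = cpfl_cost s.
  case: s => [[op a] py]; rewrite /cpfl_cost /service_cost /=.
  by congr (_ + _ + _); apply: eq_bigr => j _; rewrite ffunE.
pose t0 := (set0 : {set 'I_n}, [ffun j : 'I_n => j], clients I).
have f0 : boolp.asbool (cpfl_feasible (sol t0)).
  apply/boolp.asboolP; split=> //=; split=> //=; rewrite ?sub0set // => j.
    by rewrite /served /= setDv inE.
  by rewrite inE.
pose P t := boolp.asbool (cpfl_feasible (sol t)).
case: (@arg_minP _ _ _ t0 P (fun t => cpfl_cost (sol t)) f0)
  => t /boolp.asboolP ft ot.
exists (sol t); split=> // s fs; rewrite /= -(code_cost s).
by apply: ot; apply/boolp.asboolP; apply: code_feasible.
Qed.

End Reduction.

(** * Computing the reduction *)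

Lemma enum_set_filter (T : finType) (A : {pred T}) (p : pred T) :
  enum [set x in A | p x] = filter p (enum A).
Proof.
rewrite /enum_mem -filter_predI; apply: eq_filter => x.
by rewrite !inE /= andbC.
Qed.

(** On the underlying numbers, both sides are [iota 0 (m + n)]. *)
Lemma enum_ordD m n :
  enum 'I_(m + n) = map (@lshift m n) (enum 'I_m) ++ map (@rshift m n)
    (enum 'I_n).
Proof.
have val_enum k : map (@nat_of_ord k) (enum 'I_k)
  = iota 0 k by exact: val_enum_ord.
apply: (inj_map (@ord_inj (m + n))); rewrite val_enum map_cat.
rewrite -(map_comp (@nat_of_ord _) (@lshift m n)) -(map_comp (@nat_of_ord _)
  (@rshift m n)).
have -> : map (@nat_of_ord _ \o @lshift m n) (enum 'I_m) = iota 0 m.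
  by rewrite -val_enum; apply: eq_map.
have -> : map (@nat_of_ord _ \o @rshift m n) (enum 'I_n) = iota m n.
  rewrite -[in RHS](addn0 m) iotaDl -val_enum -(map_comp (addn m)).
  exact: eq_map.
by rewrite iotaD.
Qed.

Lemma enum_setD m n (A : {set 'I_(m + n)}) :
  enum A = map (@lshift m n) (enum [set i | lshift n i \in A])
    ++ map (@rshift m n) (enum [set i | rshift m i \in A]).
Proof.
have enumE (T : finType) (B : {set T}) : enum B = filter (fun x => x \in B)
  (enum T).
  by rewrite /enum_mem -filter_predI; apply: eq_filter => x; rewrite /= andbT.
rewrite !enumE enum_ordD filter_cat.
rewrite (filter_map (@lshift m n)) (filter_map (@rshift m n)).
congr (_ ++ _).
  by congr map; apply: (@eq_filter 'I_m) => i; rewrite /= inE.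
by congr map; apply: (@eq_filter 'I_n) => i; rewrite /= inE.
Qed.

Lemma lookup_ord n (v : 'I_n -> val) d (k : 'I_n) l :
  foldl (fun a (t : 'I_n) => if nat_of_ord t == nat_of_ord k then v t else a)
    d l
  = if k \in l then v k else d.
Proof.
elim: l d => [|t l IH] d //=; rewrite IH inE (inj_eq (@ord_inj n)) eq_sym.
by case: eqVneq => [->|_] //=; case: ifP.
Qed.

Lemma lookup_has T (f : T -> nat) k b l :
  foldl (fun a t => if f t == k then of_bool true else a) (of_bool b) l
  = of_bool (b || has (fun t => f t == k) l).
Proof.
elim: l b => [|t l IH] b /=; first by rewrite orbF.
by case: eqP => _; rewrite IH ?orbT.
Qed.

Local Notation points I := (enum 'I_(npoints I)).
Local Notation inst := enc_cpfl_instance.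

(** * Data read off the encoded instance *)

Lemma ptime_npoints : ptime inst (fun I => enc_nat (npoints I)).
Proof. exact: ptime_fst (ptime_fst (ptime_id _)). Qed.

Lemma ptime_dist : ptime inst (fun I => enc_list
  [seq enc_list [seq Defs.Num (dist x y) | y <- points I] | x <- points I]).
Proof. exact: ptime_fst (ptime_snd (ptime_fst (ptime_id _))). Qed.

Lemma ptime_facilities : ptime inst (fun I => enc_list
  [seq enc_list [:: enc_nat (nat_of_ord i); Defs.Num (opening i);
    enc_nat (capacity i)]
  | i <- enum (facilities I)]).
Proof. exact: ptime_fst (ptime_snd (ptime_snd (ptime_fst (ptime_id _)))). Qed.

Lemma ptime_clients : ptime inst (fun I => enc_list
  [seq enc_nat (nat_of_ord j) | j <- enum (clients I)]).
Proof. exact: ptime_fst (ptime_snd (ptime_snd (ptime_snd (ptime_fst (ptime_id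
  _))))). Qed.

Lemma ptime_penalties : ptime inst (fun I => enc_list
  [seq Defs.Num (penalty j) | j <- enum (clients I)]).
Proof. exact: ptime_snd (ptime_id _). Qed.

(** The number of points is in binary and offers nothing to fold over; the list of rows of the
    distance matrix has the right length. *)
Lemma ptime_points : ptime inst (fun I => enc_list
  [seq enc_nat (nat_of_ord x) | x <- points I]).
Proof.
apply: ptime_ext (ptime_iota ptime_dist) => I.
by rewrite size_enum_ord -val_enum_ord -(map_comp enc_nat).
Qed.

Lemma ptime_charged_penalty : ptime inst (fun I => enc_list
  [seq Pair (enc_nat (nat_of_ord j)) (Defs.Num (penalty j))
    | j <- enum (charged I)]).
Proof.
have hp := ptime_filter (ptime_zip ptime_clients ptime_penalties)
  (p := fun I j => (0 < penalty j)%R).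
apply: ptime_ext (hp _) => [I|]; first by rewrite -enum_set_filter.
set inp := extend _ _.
have h : ptime inp (fun y => Defs.Num (penalty (tagged y)))
  by exact: ptime_snd (ptime_var _ _).
apply: ptime_ext (ptime_not (ptime_le h (ptime_num _ 0%R))) => y.
by rewrite -ltNge.
Qed.

Lemma ptime_charged : ptime inst (fun I => enc_list
  [seq enc_nat (nat_of_ord j) | j <- enum (charged I)]).
Proof.
apply: (ptime_map ptime_charged_penalty (g
  := fun I j => enc_nat (nat_of_ord j))).
exact: ptime_fst (ptime_var _ _).
Qed.

Lemma ptime_weights : ptime inst (fun I => enc_list
  [seq Pair (enc_nat (nat_of_ord x)) (Defs.Num (weight x)) | x <- points I]).
Proof.
apply: (ptime_map ptime_points (g
  := fun I x => Pair (enc_nat (nat_of_ord x)) (Defs.Num (weight x)))).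
set inp := extend _ _; have hx : ptime inp (fun y => enc_nat (tagged y))
  by exact: ptime_var.
apply: (ptime_pair hx).
(* The default 1 of the search is the weight of an uncharged point. *)
have := ptime_lookup (ptime_weak _ ptime_charged_penalty)
  hx (ptime_num inp 1%R).
apply: ptime_ext => y; rewrite lookup_ord mem_enum /weight.
by case: ifP.
Qed.

(* Rows of the points of the instance and of their dummies in the new distance
   matrix. *)
Definition row_top (I : cpfl_instance) (x : 'I_(npoints I)) : val := enc_list
  ([seq Defs.Num (dist x y) | y <- points I]
   ++ [seq Defs.Num (dist x y + weight y)%R | y <- points I]).

Definition row_bottom (I : cpfl_instance) (x : 'I_(npoints I)) : val := enc_list
  ([seq Defs.Num (dist x y + weight x)%R | y <- points I]
   ++ [seq Defs.Num (if x == y then 0 else dist x y + weight y + weight x)%R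
      | y <- points I]).

Lemma enc_pendant_dist (I : cpfl_instance) :
  [seq enc_list [seq Defs.Num (@pendant_dist I u v)
    | v <- enum 'I_(npoints I + npoints I)]
  | u <- enum 'I_(npoints I + npoints I)]
  = map (@row_top I) (points I) ++ map (@row_bottom I) (points I).
Proof.
rewrite enum_ordD map_cat.
rewrite -(map_comp _ (@lshift _ _)) -(map_comp _ (@rshift _ _)).
congr (_ ++ _); apply: eq_map => x; rewrite /row_top /row_bottom /= map_cat;
  rewrite -(map_comp _ (@lshift _ _)) -(map_comp _ (@rshift _ _));
  by congr (enc_list (_ ++ _)); apply: eq_map => y;
    rewrite /= /pendant_dist !splitE.
Qed.

(** Zipping the rows with [ptime_weights] puts the index and weight of a row in scope; a second zip
    inside the row does the same for each column. *)
Lemma ptime_pendant_dist : ptime inst (fun I => enc_list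
  [seq enc_list [seq Defs.Num (@pendant_dist I u v)
    | v <- enum 'I_(npoints I + npoints I)]
  | u <- enum 'I_(npoints I + npoints I)]).
Proof.
have hrow := ptime_zip ptime_weights ptime_dist.
suff h : ptime inst (fun I => enc_list (map (@row_top I) (points I)))
    /\ ptime inst (fun I => enc_list (map (@row_bottom I) (points I))).
  have [ht hb] := h; apply: ptime_ext (ptime_cat ht hb) => I.
  by rewrite enc_pendant_dist.
split; apply: (ptime_map hrow); set inp := extend _ _;
  have hxw : ptime inp (fun y => Pair (enc_nat (tagged y))
    (Defs.Num (weight (tagged y))))
    by [exact: ptime_fst (ptime_var _ _)];
  have hd : ptime inp (fun y => enc_list [seq Defs.Num (dist (tagged y) z)
      | z <- points (tag y)]) by [exact: ptime_snd (ptime_var _ _)];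
  have hx := ptime_fst hxw; have hw := ptime_snd hxw;
  have hz := ptime_zip (ptime_weak _ ptime_weights) hd.
- apply: (ptime_cat hd); apply: (ptime_map hz
    (g := fun y z => Defs.Num (dist (tagged y) z + weight z)%R)).
  by apply: ptime_add; [exact: ptime_snd (ptime_var _ _)|exact: ptime_snd
    (ptime_fst (ptime_var _ _))].
- apply: ptime_cat.
    apply: (ptime_map hd (g := fun y z => Defs.Num (dist (tagged y)
      z + weight (tagged y))%R)).
    by apply: ptime_add; [exact: ptime_var|exact: ptime_weak hw].
  apply: (ptime_map hz (g := fun y z => Defs.Num (if tagged y == z then 0
    else dist (tagged y) z + weight z + weight (tagged y))%R)).
  set inp' := extend _ _.
  have he : ptime inp' (fun y => of_bool (tagged (tag y) == tagged y)).
    have := ptime_eqn (ptime_weak _ hx : ptime inp' (fun y => enc_nat (tagged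
      (tag y))))
      (ptime_fst (ptime_fst (ptime_var _ _))
        : ptime inp' (fun y => enc_nat (tagged y))).
    by apply: ptime_ext => y.
  have hs : ptime inp' (fun y => Defs.Num (dist (tagged (tag y)) (tagged y)
      + weight (tagged y) + weight (tagged (tag y)))%R).
    apply: ptime_add; last exact: ptime_weak hw.
    by apply: ptime_add; [exact: ptime_snd (ptime_var _ _)|exact: ptime_snd
      (ptime_fst (ptime_var _ _))].
  by apply: ptime_ext (ptime_if he (ptime_num _ 0%R) hs) => y; case: ifP.
Qed.

Lemma enum_red_clients (I : cpfl_instance) :
  enum (red_clients I) = map (@lshift _ _) (enum (charged I)).
Proof.
rewrite enum_setD.
have -> : [set i | rshift (npoints I) i \in red_clients I] = set0.
  by apply/setP => i; rewrite in_set [LHS]in_set splitE inE.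
rewrite enum_set0 cats0.
have -> // : [set i | lshift (npoints I) i \in red_clients I] = charged I.
by apply/setP => j; rewrite in_set mem_red_clients.
Qed.

Lemma ptime_red_facilities : ptime inst (fun I => enc_list
  [seq enc_list [:: enc_nat (nat_of_ord u); Defs.Num (@red_opening I u);
    enc_nat (@red_capacity I u)] | u <- enum (red_facilities I)]).
Proof.
pose new (I : cpfl_instance) (j : 'I_(npoints I)) :=
  enc_list [:: enc_nat (npoints I + j); Defs.Num 0%R; enc_nat 1].
have hnew : ptime inst (fun I => enc_list (map (@new I) (enum (charged I)))).
  apply: (ptime_map ptime_charged); set inp := extend _ _.
  have h0 : ptime inp (fun=> Defs.Num 0%R) := ptime_num _ _.
  have h1 : ptime inp (fun=> enc_nat 1) := ptime_num _ _.
  (* The first [h0] is the opening cost, the last one the end of the list. *)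
  apply: ptime_pair (ptime_pair h0 (ptime_pair h1 h0)).
  by apply: ptime_addn; [exact: ptime_weak ptime_npoints|exact: ptime_var].
apply: ptime_ext (ptime_cat ptime_facilities hnew) => I; congr enc_list.
rewrite enum_setD map_cat -(map_comp _ (@lshift _ _))
  -(map_comp _ (@rshift _ _)).
have -> : [set i | lshift (npoints I) i \in red_facilities I] = facilities I.
  by apply/setP => i; rewrite !inE splitE.
have -> : [set i | rshift (npoints I) i \in red_facilities I] = charged I.
  by apply/setP => i; rewrite in_set [LHS]in_set splitE.
by congr (_ ++ _); apply: eq_map => j;
  rewrite /= /red_opening /red_capacity splitE.
Qed.

Lemma ptime_reduction : ptime inst (fun I => enc_cfl_instance (reduction I)).
Proof.
apply: ptime_pair.
  exact: ptime_addn ptime_npoints ptime_npoints.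
apply: ptime_pair; first exact: ptime_pendant_dist.
apply: ptime_pair; first exact: ptime_red_facilities.
apply: ptime_pair; last exact: ptime_num.
apply: ptime_ext ptime_charged => I.
by rewrite /enc_set enum_red_clients -(map_comp _ (@lshift _ _)).
Qed.

(** * Computing the converted solution *)

Definition solved : Type := {I : cpfl_instance & cfl_solution (reduction I)}.

Definition enc_solved (y : solved) : val :=
  Pair (inst (tag y)) (enc_cfl_solution (tagged y)).

(** Only values at charged clients are recorded, so a swap must be computed from these alone. *)
Definition enc_assigned (I : cpfl_instance)
    (b : 'I_(npoints I + npoints I) -> 'I_(npoints I + npoints I)) : val :=
  enc_list [seq Pair (enc_nat (nat_of_ord j)) (enc_nat (b (lshift _ j)))
           | j <- enum (charged I)].

(** * Computing one swap *)

Section Swap.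

Variables (Y : Type) (inp : Y -> val) (inst_of : Y -> cpfl_instance).
Let I y := inst_of y.
Variables (b : forall y, 'I_(npoints (I y) + npoints (I y)) ->
                         'I_(npoints (I y) + npoints (I y))).
Variable (j : forall y, 'I_(npoints (I y))).

Hypothesis hI : ptime inp (fun y => inst (I y)).
Hypothesis hb : ptime inp (fun y => enc_assigned (@b y)).
Hypothesis hj : ptime inp (fun y => enc_nat (nat_of_ord (j y))).

Lemma ptime_swap : ptime inp (fun y => enc_assigned (swap (@b y) (j y))).
Proof.
have hn : ptime inp (fun y => enc_nat (npoints (I y)))
  := ptime_reindex ptime_npoints hI.
have hdj := ptime_addn hn hj.
have hval : ptime (extend inp (fun y (t : 'I_(npoints (I y))) =>
    Pair (enc_nat t) (enc_nat (b (lshift _ t)))))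
    (fun z => enc_nat (b (lshift _ (tagged z)))) := ptime_snd (ptime_var _ _).
have hkey : ptime (extend inp (fun y (t : 'I_(npoints (I y))) =>
    Pair (enc_nat t) (enc_nat (b (lshift _ t)))))
    (fun z => enc_nat (tagged z)) := ptime_fst (ptime_var _ _).
have hmem : ptime inp (fun y => of_bool (j y \in charged (I y))).
  have hT : ptime inp (fun y => enc_list [seq Pair (enc_nat (nat_of_ord t))
    (of_bool true)
      | t <- enum (charged (I y))]).
    apply: (ptime_map (ptime_reindex ptime_charged hI)
      (g := fun y t => Pair (enc_nat (nat_of_ord t)) (of_bool true))).
    by apply: ptime_pair; [exact: ptime_var|exact: ptime_bool].
  apply: ptime_ext (ptime_lookup hT hj (ptime_bool _ false)) => y.
  by rewrite (@lookup_ord _ (fun=> of_bool true)) mem_enum; case: ifP.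
(* Keyed by the assigned points, the table becomes an association list in which searching for the
   dummy decides whether it is used. *)
have hused : ptime inp (fun y => of_bool
    (has (fun t => b (lshift _ t) == npoints (I y) + j y :> nat)
      (enum (charged (I y))))).
  have hT : ptime inp (fun y => enc_list [seq Pair (enc_nat (b (lshift _ t)))
    (of_bool true)
      | t <- enum (charged (I y))]).
    apply: (ptime_map hb (g := fun y t => Pair (enc_nat (b (lshift _ t)))
      (of_bool true))).
    by apply: ptime_pair; [exact: hval|exact: ptime_bool].
  apply: ptime_ext (ptime_lookup hT hdj (ptime_bool _ false)) => y.
  by rewrite lookup_has.
(* The value 0 is what a failed search returns; it is read only if [dummy_used] holds, where [j y]
   is charged. *)
pose aj y : nat := if j y \in charged (I y) then nat_of_ord (b (lshift _ (j y)))
  else 0.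
have haj : ptime inp (fun y => enc_nat (aj y)).
  apply: ptime_ext (ptime_lookup hb hj (ptime_num _ 0%R)) => y.
  rewrite (@lookup_ord _ (fun t => enc_nat (b (lshift _ t)))) mem_enum /aj.
  by case: ifP.
pose new y (t : 'I_(npoints (I y))) := Pair (enc_nat t) (enc_nat
  (if b (lshift _ t) == npoints (I y) + j y :> nat then aj y
   else if t == j y :> nat then npoints (I y)
     + j y else nat_of_ord (b (lshift _ t)))).
have hnew : ptime inp (fun y => enc_list (map (@new y) (enum (charged (I y))))).
  apply: (ptime_map hb (g := new)); set inp' := extend _ _.
  have hj' : ptime inp' (fun z => enc_nat (j (tag z))) := ptime_weak _ hj.
  have hdj' : ptime inp' (fun z => enc_nat (npoints (I (tag z)) + j (tag z)))
    := ptime_weak _ hdj.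
  apply: (ptime_pair hkey).
  have h1 := ptime_if (ptime_eqn hkey hj') hdj' hval.
  have h2 := ptime_if (ptime_eqn hval hdj') (ptime_weak _ haj) h1.
  by apply: ptime_ext h2 => z; do 2!(case: (nat_of_ord _ == _) => //).
apply: ptime_ext (ptime_if (ptime_and hmem hused) hnew hb) => y.
have eq_dummy u : (b u == npoints (I y) + j y :> nat) = (b u == rshift _ (j y))
  by [].
rewrite /enc_assigned.
have usedE : dummy_used (@b y) (j y) = (j y \in charged (I y)) &&
    has (fun t => b (lshift _ t) == npoints (I y) + j y :> nat)
      (enum (charged (I y))).
  rewrite /dummy_used; congr (_ && _); apply/exists_inP/hasP => [[u]|[t]].
    rewrite red_clientsE => /imsetP[t tQ ->] bt; exists t => //.
    by rewrite mem_enum.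
  by rewrite mem_enum => tQ bt; exists (lshift _ t); rewrite ?mem_red_clients.
rewrite -usedE; case: ifP => used; congr enc_list; apply: eq_map => t;
  rewrite /swap used //= /new eq_dummy.
rewrite (inj_eq (@ord_inj _)) (inj_eq (@lshift_inj _ _)) /aj.
have -> : j y \in charged (I y) by move: used; rewrite usedE => /andP[].
by case: ifP => // _; case: ifP.
Qed.

End Swap.

(** * Computing the CPFL solution *)

Section Unreduce.

Let ptime_inst : ptime enc_solved (fun y => inst (tag y))
  := ptime_fst (ptime_id _).

Let ptime_solved f (hf : ptime inst f) : ptime enc_solved (fun y => f (tag y))
  :=
  ptime_reindex hf ptime_inst.

Lemma ptime_settle : ptime enc_solved (fun y => enc_assigned (settle (assigned
  (tagged y)))).
Proof.
have hQ := ptime_solved ptime_charged.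
have [qs hqs] := ptime_size (ptime_solved ptime_points).
pose L y := qs.[val_size (enc_solved y)]%R.
(* [L] bounds the number of points [n]. Whatever the assignment, its table has at most [n] entries,
   each pairing a number below [n] with one below [n + n], so iterated swaps cannot make it grow. *)
pose h y := 3 + L y * ((1 + (L y + 3) + (L y + L y + 3)) + 1).
apply: (@ptime_fold solved enc_solved (fun y => 'I_(npoints (tag y)))
  (fun y => 'I_(npoints (tag y) + npoints (tag y)) ->
    'I_(npoints (tag y) + npoints (tag y)))
  _ _ (fun y => assigned (tagged y)) (fun y => @enc_assigned (tag y))
  (fun y => @swap (tag y)) h hQ).
- have : ptime enc_solved (fun y => enc_cfl_solution (tagged y))
  := ptime_snd (ptime_id _).
  move/ptime_snd; apply: ptime_ext => y.
  by rewrite /= enum_red_clients -(map_comp _ (@lshift _ _)).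
- set inp := extend _ _; have h0 := @ptime_id _ inp.
  apply: (@ptime_swap _ inp (fun z => tag (tag z)) (fun z => (tagged z).1)
    (fun z => (tagged z).2)).
  + exact: ptime_weak ptime_inst.
  + exact: ptime_fst (ptime_fst h0).
  + exact: ptime_snd (ptime_fst h0).
- by rewrite /h /L; polyb_tac.
- move=> y k; move: (foldl _ _ _) => b.
  have le_n : npoints (tag y) <= L y.
    apply: leq_trans (hqs y); apply: leq_trans (size_enc_list_ge _).
    by rewrite size_map size_enum_ord.
  apply: leq_trans (@size_enc_list_bound _ _ _ (1 + (L y + 3) + (L y + L y + 3))
    _) _.
    move=> t; have := size_enc_nat t; have := size_enc_nat (b (lshift _ t)).
    have := ltn_ord t; have := ltn_ord (b (lshift _ t)).
    rewrite /=; lia.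
  rewrite leq_add2l leq_mul2r; apply/orP; right; apply: leq_trans le_n.
  by rewrite -cardE -[leqRHS]card_ord max_card.
Qed.

Lemma ptime_opened : ptime enc_solved (fun y => enc_set (opened (unreduce
  (tagged y)))).
Proof.
have hop : ptime enc_solved (fun y => enc_list
    [seq enc_nat (nat_of_ord u) | u <- enum (opened (tagged y))]).
  exact: ptime_fst (ptime_snd (ptime_id _)).
have hn := ptime_solved ptime_npoints.
have hf := ptime_filter hop (p := fun y u => ~~ (npoints (tag y) <= u)).
apply: ptime_ext (hf _) => [y|];
  last by apply: ptime_not (ptime_leq (ptime_weak _ hn) (ptime_var _ _)).
rewrite /enc_set; congr enc_list; rewrite enum_setD filter_cat map_cat.
rewrite (filter_map (@lshift _ _)) (filter_map (@rshift _ _)).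
rewrite (eq_filter (a2 := predT)); last by move=> i /=; rewrite -ltnNge ltn_ord.
rewrite filter_predT [X in _ ++ X](_ : _ = [::])
  ?cats0 -?(map_comp _ (@lshift _ _)) //.
rewrite (eq_filter (a2 := pred0)) ?filter_pred0 // => i.
by rewrite /= leq_addr.
Qed.

Lemma ptime_served : ptime enc_solved (fun y =>
  enc_list [seq Pair (enc_nat (nat_of_ord j))
    (enc_nat (assigned (unreduce (tagged y)) j))
           | j <- enum (served (unreduce (tagged y)))]).
Proof.
have hn := ptime_solved ptime_npoints.
have hf := ptime_filter ptime_settle
  (p := fun y j => ~~ (npoints (tag y) <= settle (assigned (tagged y))
    (lshift _ j))).
apply: ptime_ext (hf _) => [y|].
  have -> : served (unreduce (tagged y)) = [set j in charged (tag y) |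
      ~~ (npoints (tag y) <= settle (assigned (tagged y)) (lshift _ j))].
    by apply/setP => j; rewrite served_unreduce [RHS]in_set -ltnNge.
  rewrite enum_set_filter; congr enc_list; apply/eq_in_map => j.
  rewrite mem_filter -ltnNge => /andP[lt_n _].
  congr (Pair _ (enc_nat _)) => /=; move: lt_n.
  by case: (split_ordP (settle _ _)) => i -> //=; lia.
by apply: ptime_not (ptime_leq (ptime_weak _ hn) _);
  exact: ptime_snd (ptime_var _ _).
Qed.

Lemma ptime_paying : ptime enc_solved (fun y => enc_set (paying (unreduce
  (tagged y)))).
Proof.
have hn := ptime_solved ptime_npoints.
(* With [npoints] as default, the single test [npoints <= v] also selects the clients of penalty
   0. *)
pose v (y : solved) (j : 'I_(npoints (tag y))) : nat :=
  if j \in charged (tag y) then nat_of_ord (settle (assigned (tagged y))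
    (lshift _ j))
  else npoints (tag y).
have hf := ptime_filter (ptime_solved ptime_clients) (p
  := fun y j => npoints (tag y) <= v y j).
apply: ptime_ext (hf _) => [y|].
  rewrite /enc_set enum_set_filter; congr (enc_list (map _ _)).
  apply: eq_in_filter => j; rewrite mem_enum => jC.
  by rewrite /v in_set jC /=; case: ifP => //=; rewrite leqnn.
set inp := extend _ _; have hn' : ptime inp (fun z => enc_nat (npoints (tag (tag
  z)))).
  exact: ptime_weak hn.
apply: (ptime_leq hn').
have hk : ptime inp (fun z => enc_nat (tagged z)) := ptime_var _ _.
apply: ptime_ext (ptime_lookup (ptime_weak _ ptime_settle) hk hn') => z.
rewrite (@lookup_ord _ (fun t => enc_nat (settle _ (lshift _ t)))) mem_enum /v.
by case: ifP.
Qed.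

Lemma ptime_unreduce : ptime enc_solved (fun y => enc_cpfl_solution (unreduce
  (tagged y))).
Proof. exact: ptime_pair (ptime_pair ptime_opened ptime_served) ptime_paying.
  Qed.

End Unreduce.

(** The solution [s] must not depend on the optimum, since the program has a single run to continue
    with. One existing optimum provides [s], and all optima have equal cost. *)
Lemma approx_unreduce (R : realType) (beta : R) (I : cpfl_instance) v :
  (forall opt : cfl_solution (reduction I), @optimal CFL (reduction I) opt ->
    exists s : cfl_solution (reduction I), [/\ v = enc_cfl_solution s,
      cfl_feasible s
      & (ratr (cfl_cost s) <= beta * ratr (cfl_cost opt))%R]) ->
  exists s : cfl_solution (reduction I), v = enc_cfl_solution s /\
    forall opt : cpfl_solution I, @optimal CPFL I opt ->
      cpfl_feasible (unreduce s) /\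
      (ratr (cpfl_cost (unreduce s)) <= beta * ratr (cpfl_cost opt))%R.
Proof.
move=> hv; have [opt0 opt0P] := cpfl_optimum_exists I.
have [embP embC] := embed_optimal opt0P.
have [s [-> fs cs]] := hv _ embP.
exists s; split=> // opt optP; split; first exact: unreduce_feasible.
have -> : cpfl_cost opt = cpfl_cost opt0.
  by apply/eqP; rewrite eq_le; apply/andP; split;
    [apply: (optP.2 _ opt0P.1)|apply: (opt0P.2 _ optP.1)].
rewrite -embC; apply: le_trans cs.
by rewrite ler_rat; apply: unreduce_cost.
Qed.

(** * Composing reduction, CFL program and conversion *)

Theorem theorem5 (R : realType) (beta : R) :
  (exists c : prog, poly_time_approx beta CFL c) ->
  exists c : prog, poly_time_approx beta CPFL c.
Proof.
move=> [c [q hc]]; pose B := (prog_bound c).+1.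
have [cpre [qpre hpre]] := ptime_reduction B.+1.
have [cpost [qpost hpost]] := ptime_unreduce B.+1.
have [qred hqred] := ptime_size ptime_reduction.
exists (Seq (Assign B (Var 0)) (Seq (Assign B.+1 (Var 0)) (Seq cpre
  (Seq (Assign 0 (Var B.+1)) (Seq c (Seq (Assign B.+1 (Bin MkPair (Var B)
    (Var 0)))
  (Seq cpost (Assign 0 (Var B.+1))))))))).
(* [S] will bound the size of the reduced instance, [V] that of the output of [c], and [W] that of
   the input of the conversion. *)
pose N (I : cpfl_instance) := val_size (inst I).
pose S I := qred.[N I]%R.
pose V I := (S I + q.[S I]%R).
pose W I := (1 + N I + V I).
have [p hp] : poly_bounded N (fun I => N I + N I + qpre.[N I]%R + S I + q.[S
  I]%R
    + (W I + N I + V I) + qpost.[W I]%R + (W I + qpost.[W I]%R)).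
  by rewrite /W /V /S; polyb_tac.
exists p => I; have {}hp := hp I; have {}hqred : _ <= S I := hqred I.
have [tc [v [[sc [ec rc]] le_tc hv]]] := hc (reduction I).
have [s [vE hs]] := approx_unreduce hv.
pose s0 := update (fun=> Defs.Num 0%R) 0 (inst I).
pose s1 := update (update s0 B (inst I)) B.+1 (inst I).
have [|t2 [s2 [e2 r2 f2 le2]]] := hpre I s1; first by rewrite /s1; upd.
pose s3 := update s2 0 (enc_cfl_instance (reduction I)).
(* Below [B], the store [s3] agrees with the initial store of [c]: the reduction left these
   registers alone and only register 0 was overwritten. *)
have [||s4 [e4 f4 g4]] := exec_frame (B := B) ec _ (s2 := s3).
- exact: leqnSn.
- move=> y ltyB; rewrite /s3 /update; case: eqP => // /eqP y0.
  by rewrite f2 /s1 /s0; [upd|lia].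
have s4_0 : s4 0 = v by rewrite -f4.
have s4_B : s4 B = inst I.
  by rewrite g4 // /s3; upd; rewrite f2 // /s1; upd.
pose y : solved := existT _ I s.
pose s5 := update s4 B.+1 (enc_solved y).
have [|t6 [s6 [e6 r6 f6 le6]]] := hpost y s5; first by rewrite /s5; upd.
eexists; exists (enc_cpfl_solution (unreduce s)); split.
- exists (update s6 0 (enc_cpfl_solution (unreduce s))); split; last by upd.
  apply: ExecSeq; first exact: ExecAssign.
  apply: ExecSeq; first exact: ExecAssign.
  have -> : update (update s0 B (eval s0 (Var 0))) B.+1
      (eval (update s0 B (eval s0 (Var 0))) (Var 0)) = s1.
    by rewrite /s1 /s0 /=; upd.
  apply: ExecSeq; first exact: e2.
  apply: ExecSeq; first exact: ExecAssign.
  rewrite [eval s2 _]r2 -/s3.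
  apply: ExecSeq; first exact: e4.
  apply: ExecSeq; first exact: ExecAssign.
  have -> : eval s4 (Bin MkPair (Var B) (Var 0)) = enc_solved y.
    by rewrite /= s4_0 s4_B vE.
  apply: ExecSeq; first exact: e6.
  by rewrite -[enc_cpfl_solution _]r6; apply: ExecAssign.
- apply: leq_trans hp; cbn [eval_cost eval eval_binop].
  rewrite s4_0 s4_B r2 r6 /s0; upd.
  have size_pair v1 v2 : val_size (Pair v1 v2)
    = 1 + val_size v1 + val_size v2 by [].
  have size_v : val_size v <= V I.
    rewrite -rc; apply: leq_trans (exec_size ec 0) _; upd.
    by rewrite leq_add // (leq_trans le_tc) // horner_nat_mono.
  have size_y : val_size (enc_solved y) <= W I.
    have -> : val_size (enc_solved y) = 1 + N I + val_size v by rewrite vE.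
    by rewrite /W; lia.
  have size_o : val_size (enc_cpfl_solution (unreduce s))
    <= W I + qpost.[W I]%R.
    rewrite -[enc_cpfl_solution _]r6; apply: leq_trans (exec_size e6 B.+1) _.
    rewrite /s5; upd; have := horner_nat_mono qpost size_y; lia.
  have := horner_nat_mono qpost size_y.
  have le_c : tc <= q.[S I]%R by apply: leq_trans le_tc (horner_nat_mono q
    hqred).
  change (enc_instance I) with (inst I); change (tagged y) with s.
  rewrite size_pair -/(N I).
  have WE : W I = 1 + N I + V I by [].
  move: size_v le_c size_o hqred le6 le2 WE; rewrite -/(N I).
  move: (qpost.[W I]%R) (qpost.[_]%R) (qpre.[N I]%R) (q.[S I]%R) (S I) (V I)
    (W I) (N I).
  move: (val_size v) (val_size (enc_cpfl_solution _))
    (val_size (enc_cfl_instance _)).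
  clear; lia.
- by move=> opt /hs[fs cs]; exists (unreduce s).
Qed.
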